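(* Let $\alpha$ be an even positive integer, $\beta$ an odd positive integer, and $C>0$. Consider the polynomial planar system $$\dot u=-v(u^2+v^2)^{\alpha+\beta}+Cu^{\beta}v^{\alpha}(u^2-v^2),\qquad \dot v=u(u^2+v^2)^{\alpha+\beta}+2Cu^{\beta+1}v^{\alpha+1}.$$ Then every nontrivial trajectory $\Gamma$ of this system (i.e. one starting at a point other than the origin), taken for $t\ge0$, is a spiral converging to infinity, and $$\dim_B\Gamma=2\left(1-\frac{1}{\alpha+\beta}\right).$$ Furthermore, these spirals are Minkowski nondegenerate.
   Context: This system is obtained, via the geometric inversion $u=x/(x^2+y^2)$, $v=y/(x^2+y^2)$ and multiplication by $(u^2+v^2)^{\alpha+\beta}$, from the weakly damped oscillator $\dot x=-y-Cx^\beta y^\alpha$, $\dot y=x$. For a nonempty bounded $B\subset\mathbb{R}^2$, with $B_\varepsilon$ its $\varepsilon$-neighbourhood and $|B_\varepsilon|$ its area, $\mathcal M^{*s}(B)=\limsup_{\varepsilon\to0}|B_\varepsilon|/\varepsilon^{2-s}$, $\mathcal M_*^s(B)$ is the same with $\liminf$, $\overline{\dim}_BB=\inf\{s:\mathcal M^{*s}(B)=0\}$, $\underline{\dim}_BB=\inf\{s:\mathcal M_*^{s}(B)=0\}$, $\dim_BB$ their common value; $B$ is Minkowski nondegenerate if $0<\mathcal M_*^d(B)\le\mathcal M^{*d}(B)<\infty$ for some $d$. For an unbounded set $A\subset\mathbb{R}^2$ with $0\notin\overline A$ (such as a trajectory tail), all these notions are defined as those of the bounded set $\Phi(A)$, $\Phi(x)=x/|x|^2$.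 *)

(* Defs.v *)
From HB Require Import structures.
From mathcomp Require Import all_boot all_order all_algebra.
From mathcomp Require Import all_classical all_reals all_analysis.
Set Implicit Arguments. Unset Strict Implicit. Unset Printing Implicit Defensive.
Import Order.TTheory GRing.Theory Num.Theory.
Import numFieldNormedType.Exports.
Local Open Scope classical_set_scope.
Local Open Scope ring_scope.

Section Defs.
Variable R : realType.

Definition eps_nbhd (B : set (R * R)) (e : R) : set (R * R) :=
  [set p | exists2 b, B b & (p.1 - b.1) ^+ 2 + (p.2 - b.2) ^+ 2 < e ^+ 2].

Definition area (A : set (R * R)) : \bar R :=
  ((@lebesgue_measure R) \x (@lebesgue_measure R))%E A.

Definition mink_ratio (B : set (R * R)) (s e : R) : \bar R :=
  (area (eps_nbhd B e) * ((e `^ (2 - s))^-1)%:E)%E.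

Definition upper_mink (s : R) (B : set (R * R)) : \bar R :=
  ereal_inf [set ereal_sup [set mink_ratio B s e | e in [set e : R | 0 < e < d]]
            | d in [set d : R | 0 < d]].

Definition lower_mink (s : R) (B : set (R * R)) : \bar R :=
  ereal_sup [set ereal_inf [set mink_ratio B s e | e in [set e : R | 0 < e < d]]
            | d in [set d : R | 0 < d]].

Definition upper_box_dim (B : set (R * R)) : \bar R :=
  ereal_inf [set s%:E | s in [set s : R | upper_mink s B = 0%E]].

Definition lower_box_dim (B : set (R * R)) : \bar R :=
  ereal_inf [set s%:E | s in [set s : R | lower_mink s B = 0%E]].

Definition mink_nondegenerate (B : set (R * R)) : Prop :=
  exists d : R, (0 < lower_mink d B)%E /\ (lower_mink d B <= upper_mink d B)%E
                /\ (upper_mink d B < +oo)%E.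

Definition inversion (p : R * R) : R * R :=
  (p.1 / (p.1 ^+ 2 + p.2 ^+ 2), p.2 / (p.1 ^+ 2 + p.2 ^+ 2)).

Definition tint (T : \bar R) : set R := [set t | 0 <= t /\ (t%:E < T)%E].

Definition tends_to_pinfty (f : R -> R) (T : \bar R) : Prop :=
  forall M : R, exists2 s, tint T s & forall t, tint T t -> s <= t -> M < f t.

Definition spiral_to_infinity (u v : R -> R) (T : \bar R) : Prop :=
  let r := fun t => Num.sqrt (u t ^+ 2 + v t ^+ 2) in
  (forall t, tint T t -> (u t, v t) <> (0, 0)) /\
  (forall s t, tint T s -> tint T t -> s <= t -> r s <= r t) /\
  tends_to_pinfty r T /\
  exists theta : R -> R,
    {within tint T, continuous theta} /\
    (forall t, tint T t -> u t = r t * cos (theta t) /\ v t = r t * sin (theta t)) /\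
    exists2 t0, tint T t0 &
      ((forall s t, tint T s -> tint T t -> t0 <= s -> s < t -> theta s < theta t)
        /\ tends_to_pinfty theta T)
      \/
      ((forall s t, tint T s -> tint T t -> t0 <= s -> s < t -> theta t < theta s)
        /\ tends_to_pinfty (fun t => - theta t) T).

Definition fieldU (a b : nat) (C u v : R) : R :=
  - v * (u ^+ 2 + v ^+ 2) ^+ (a + b) + C * u ^+ b * v ^+ a * (u ^+ 2 - v ^+ 2).
Definition fieldV (a b : nat) (C u v : R) : R :=
  u * (u ^+ 2 + v ^+ 2) ^+ (a + b) + 2 * C * u ^+ b.+1 * v ^+ a.+1.

End Defs.

(* Main.v *)
Require Import Defs.
From HB Require Import structures.
From mathcomp Require Import all_boot all_order all_algebra.
From mathcomp Require Import all_classical all_reals all_analysis.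
From mathcomp Require Import ring lra.
Import Order.TTheory GRing.Theory Num.Theory.
Import numFieldNormedType.Exports.
Local Open Scope classical_set_scope.
Local Open Scope ring_scope.

(* Write u + iv = E exp(i th), n = alpha + beta. The system becomes
     (ln E)' = C E^(n+1) cos^(beta+1) th sin^alpha th,
     th' = E^(2n) + C E^(n+1) cos^beta th sin^(alpha+1) th,
   so E is nondecreasing, and where E is large the curve rotates with d(E^(n-1))/d(th)
   bounded and positive on average: E^(n-1) is comparable to th, and the inverted curve is
   comparable to the spiral r = th^(-1/(n-1)). Its eps-neighbourhood has area of order
   eps^(2/n), which for eps = e^n reads e^2. Lower bound: consecutive turns at radius r are O(r^n)
   apart, so the neighbourhood contains a punctured disk of radius of order e. Upper bound: the part
   inside radius e lies in a square, and the part outside has length O(e^(2-n)).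
   The average positivity is never integrated: adding a bounded multiple of sin(4 th) to a
   Lyapunov function turns it into a pointwise bound on the derivative. *)

(** * Derivatives and monotonicity *)

Lemma is_derive_fD (R : realType) (f g : R -> R) (t a b : R) :
  is_derive t 1 f a -> is_derive t 1 g b -> is_derive t 1 (fun x => f x + g x) (a + b).
Proof. by move=> fa gb; exact: is_deriveD. Qed.

Lemma is_derive_fB (R : realType) (f g : R -> R) (t a b : R) :
  is_derive t 1 f a -> is_derive t 1 g b -> is_derive t 1 (fun x => f x - g x) (a - b).
Proof. by move=> fa gb; exact: is_deriveB. Qed.

Lemma is_derive_fM (R : realType) (f g : R -> R) (t a b : R) :
  is_derive t 1 f a -> is_derive t 1 g b ->
  is_derive t 1 (fun x => f x * g x) (a * g t + f t * b).
Proof.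
move=> fa gb; have := is_deriveM fa gb.
by rewrite /GRing.scale /= addrC [g t * a]mulrC.
Qed.

Lemma is_derive_cM (R : realType) (f : R -> R) (t a c : R) :
  is_derive t 1 f a -> is_derive t 1 (fun x => c * f x) (c * a).
Proof. by move=> fa; exact: is_deriveZ. Qed.

Lemma is_derive_sin_comp (R : realType) (f : R -> R) (t a : R) :
  is_derive t 1 f a -> is_derive t 1 (fun x => sin (f x)) (cos (f t) * a).
Proof. by move=> fa; exact: (@is_derive1_comp _ sin f). Qed.

Lemma is_derive_cos_comp (R : realType) (f : R -> R) (t a : R) :
  is_derive t 1 f a -> is_derive t 1 (fun x => cos (f x)) (- sin (f t) * a).
Proof. by move=> fa; exact: (@is_derive1_comp _ cos f). Qed.

Lemma is_derive_exp_comp (R : realType) (f : R -> R) (t a : R) :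
  is_derive t 1 f a -> is_derive t 1 (fun x => expR (f x)) (expR (f t) * a).
Proof. by move=> fa; exact: (@is_derive1_comp _ expR f). Qed.

Lemma is_derive_ln_comp (R : realType) (f : R -> R) (t a : R) :
  0 < f t -> is_derive t 1 f a -> is_derive t 1 (fun x => ln (f x)) ((f t)^-1 * a).
Proof. by move=> ft fa; apply: (@is_derive1_comp _ (@ln R) f) => //; exact: is_derive1_ln. Qed.

Lemma is_derive_cont (R : realType) (f : R -> R) (t a : R) :
  is_derive t 1 f a -> {for t, continuous f}.
Proof. by move=> fa; apply/differentiable_continuous/derivable1_diffP. Qed.

Lemma cont_within_itv (R : realType) (f : R -> R) (a b : R) :
  (forall t, a <= t <= b -> {for t, continuous f}) -> {within `[a, b], continuous f}.
Proof.
move=> fc; apply: continuous_in_subspaceT => x.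
by rewrite inE /= in_itv /= => /fc.
Qed.

Lemma derive_ge0_le (R : realType) (f g : R -> R) (a b : R) :
  (forall t, a <= t <= b -> is_derive t 1 f (g t)) ->
  (forall t, a <= t <= b -> 0 <= g t) -> a <= b -> f a <= f b.
Proof.
move=> fg g0; rewrite le_eqVlt => /orP[/eqP-> //|ab].
have [||c cab e] := @MVT R f g a b ab.
- by move=> x; rewrite in_itv /= => /andP[ax xb]; apply: fg; rewrite !ltW.
- by apply: cont_within_itv => t /fg /is_derive_cont.
rewrite -subr_ge0 e mulr_ge0 ?subr_ge0 ?(ltW ab)//.
by move: cab; rewrite in_itv /= => /andP[ax xb]; apply: g0; rewrite !ltW.
Qed.

Lemma derive_gt0_lt (R : realType) (f g : R -> R) (a b : R) :
  (forall t, a <= t <= b -> is_derive t 1 f (g t)) ->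
  (forall t, a <= t <= b -> 0 < g t) -> a < b -> f a < f b.
Proof.
move=> fg g0 ab.
have [||c cab e] := @MVT R f g a b ab.
- by move=> x; rewrite in_itv /= => /andP[ax xb]; apply: fg; rewrite !ltW.
- by apply: cont_within_itv => t /fg /is_derive_cont.
rewrite -subr_gt0 e mulr_gt0 ?subr_gt0//.
by move: cab; rewrite in_itv /= => /andP[ax xb]; apply: g0; rewrite !ltW.
Qed.

Lemma derive_bound_le (R : realType) (f g F G : R -> R) (a b : R) :
  (forall t, a <= t <= b -> is_derive t 1 f (g t)) ->
  (forall t, a <= t <= b -> is_derive t 1 F (G t)) ->
  (forall t, a <= t <= b -> `|g t| <= G t) -> a <= b -> `|f b - f a| <= F b - F a.
Proof.
move=> df dF gG ab; rewrite ler_norml.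
have h1 := @derive_ge0_le _ (fun x => F x - f x) (fun x => G x - g x) a b.
have h2 := @derive_ge0_le _ (fun x => F x + f x) (fun x => G x + g x) a b.
have {}h1 : F a - f a <= F b - f b.
  apply: h1 => // t tab; first by apply: is_derive_fB; [exact: dF|exact: df].
  by have := gG t tab; rewrite ler_norml; lra.
have {}h2 : F a + f a <= F b + f b.
  apply: h2 => // t tab; first by apply: is_derive_fD; [exact: dF|exact: df].
  by have := gG t tab; rewrite ler_norml; lra.
by apply/andP; split; lra.
Qed.

(** A curve is 1-Lipschitz in any primitive [F] of a bound on its speed. This supplies the chart
    hypothesis of [area_nbhd_Lipschitz]. Order-convexity of [P] is the form that fits time ranges
    cut out by conditions on [t] and on [E t]. *)
Lemma derive_bound_dist (R : realType) (P : set R) (f g F G : R -> R) :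
  (forall s t r, P s -> P t -> s <= r <= t -> P r) ->
  (forall t, P t -> is_derive t 1 f (g t)) ->
  (forall t, P t -> is_derive t 1 F (G t)) ->
  (forall t, P t -> `|g t| <= G t) ->
  forall s t, P s -> P t -> `|f t - f s| <= `|F t - F s|.
Proof.
move=> cvx df dF gG.
suff h s t : P s -> P t -> s <= t -> `|f t - f s| <= `|F t - F s|.
  move=> s t Ps Pt; have [st|/ltW ts] := leP s t; first exact: h.
  by rewrite distrC [leRHS]distrC; exact: h.
move=> Ps Pt st; have Pr r (h : s <= r <= t) : P r := cvx s t r Ps Pt h.
apply: le_trans (ler_norm _).
by apply: (derive_bound_le _ f g F G s t) => // r /Pr; auto.
Qed.

Lemma derive_IVT (R : realType) (f g : R -> R) (a b y : R) :
  (forall t, a <= t <= b -> is_derive t 1 f (g t)) -> a <= b ->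
  f a <= y <= f b -> exists2 c, a <= c <= b & f c = y.
Proof.
move=> fg ab /andP[fay yfb].
have [||c cab e] := @IVT R f a b y ab.
- by apply: cont_within_itv => t /fg /is_derive_cont.
- by rewrite minEle maxEle (le_trans fay yfb) fay yfb.
by exists c => //; move: cab; rewrite in_itv.
Qed.

Lemma polar_angle (R : realType) (x y r : R) : 0 < r -> x ^+ 2 + y ^+ 2 = r ^+ 2 ->
  exists psi, x = r * cos psi /\ y = r * sin psi.
Proof.
move=> r0 e.
have rn0 : r != 0 by rewrite gt_eqF.
have xr : (x / r) ^+ 2 + (y / r) ^+ 2 = 1.
  by rewrite !expr_div_n -mulrDl e divff// expf_neq0.
have xb : -1 <= x / r <= 1.
  by apply/andP; split; nra.
have cx : cos (acos (x / r)) = x / r by rewrite acosK// in_itv.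
have sx : sin (acos (x / r)) = `|y / r|.
  by rewrite sin_acos// -sqrtr_sqr; congr Num.sqrt; lra.
have [y0|y0] := leP 0 (y / r).
- exists (acos (x / r)); rewrite cx sx ger0_norm//.
  by split; field.
- exists (- acos (x / r)); rewrite cosN sinN cx sx ltr0_norm// opprK.
  by split; field.
Qed.

(** Removing whole turns brings any direction into the revolution starting at [a]. This later forces
    the spiral to meet a given direction within one turn. *)
Lemma angle_window (R : realType) (phi a : R) : exists psi,
  [/\ a <= psi, psi <= a + 2 * pi, cos psi = cos phi & sin psi = sin phi].
Proof.
have p0 : 0 < 2 * pi :> R by rewrite mulr_gt0// pi_gt0.
pose z := Num.floor ((phi - a) / (2 * pi)).
have h1 : z%:~R * (2 * pi) <= phi - a by rewrite -ler_pdivlMr// floor_le.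
have h2 : phi - a < (z + 1)%:~R * (2 * pi) by rewrite -ltr_pdivrMr// floorD1_gt.
rewrite intrD mulrDl mul1r in h2.
have turns (n : nat) : n%:R * (2 * pi) = (pi *+ 2) *+ n :> R by rewrite !mulr_natl.
exists (phi - z%:~R * (2 * pi)); split; [lra|lra| |].
(* Periodicity is iterated a natural number of times, so the sign of [z] decides whether the turns
   are added or removed. *)
- case: z {h1 h2} => n.
    by rewrite -pmulrn -[in RHS](subrK (n%:R * (2 * pi)) phi) turns (periodicn (@cosD2pi R)).
  by rewrite NegzE mulrNz mulNr opprK -pmulrn turns (periodicn (@cosD2pi R)).
- case: z {h1 h2} => n.
    by rewrite -pmulrn -[in RHS](subrK (n%:R * (2 * pi)) phi) turns (periodicn (@sinD2pi R)).
  by rewrite NegzE mulrNz mulNr opprK -pmulrn turns (periodicn (@sinD2pi R)).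
Qed.

(** * Polar form of the system *)

Lemma tint_le (R : realType) (T : \bar R) (s t : R) :
  tint T t -> 0 <= s <= t -> tint T s.
Proof.
move=> [_ tT] /andP[s0 st]; split=> //.
by apply: le_lt_trans tT; rewrite lee_fin.
Qed.

Lemma tint_open (R : realType) (T : \bar R) (t : R) :
  tint T t -> exists2 s, t < s & tint T s.
Proof.
case: T => [T||] [t0 //= tT].
- move: tT; rewrite lte_fin => tT; exists ((t + T) / 2); first lra.
  split; last by rewrite lte_fin; lra.
  lra.
- by exists (t + 1); [lra | split; [lra | rewrite ltry]].
Qed.

Lemma derive0_const (R : realType) (T : \bar R) (f : R -> R) (t : R) :
  (forall t, tint T t -> is_derive t 1 f 0) -> tint T t -> f t = f 0.
Proof.
move=> f0 tT; have t0 : 0 <= t by case: tT.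
apply/eqP; rewrite eq_le; apply/andP; split.
- rewrite -lerN2; apply: (@derive_ge0_le _ (fun x => - f x) (cst 0) 0 t) => // s st.
  have fs := f0 s (tint_le _ _ _ _ tT st).
  by have := is_deriveN fs; rewrite oppr0.
- by apply: (@derive_ge0_le _ f (cst 0) 0 t) => // s st; apply: f0 (tint_le _ _ _ _ tT st).
Qed.

(* Freezing [g] at [g 0] to the left of [0] makes the integral two-sided differentiable at [0]. *)
Lemma tint_primitive (R : realType) (T : \bar R) (g : R -> R) :
  (forall t, tint T t -> {for t, continuous g}) ->
  exists G : R -> R, forall t, tint T t -> is_derive t 1 G (g t).
Proof.
move=> gc; pose h s := g (Num.max s 0).
exists (fun x => \int[lebesgue_measure]_(t in `[-1, x]) h t) => t tT.
have [u tu uT] := tint_open _ _ _ tT.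
have t0 : 0 <= t by case: tT.
have hc s : s <= u -> {for s, continuous h}.
  move=> su; have : {for s, continuous (g \o (fun s => Num.max s 0))}; last by [].
  apply: continuous_comp.
    by apply: continuous_max; [exact: cvg_id | exact: cvg_cst].
  apply: gc; apply: tint_le uT _; rewrite le_max lexx orbT /= ge_max su.
  by rewrite (le_trans t0 (ltW tu)).
have hi : lebesgue_measure.-integrable `[-1, u] (EFin \o h).
  apply: continuous_compact_integrable; first exact: segment_compact.
  by apply: cont_within_itv => s /andP[_ su]; exact: hc.
have [||d e] := continuous_FTC1_closed tu hi.
- lra.
- exact: hc (ltW tu).
- apply: DeriveDef => //; rewrite -derive1E e /h; congr g.
  by apply/max_idPl.
Qed.

Section PolarForm.
Variables (R : realType) (alpha beta : nat) (C : R).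
Hypotheses (halpha_even : ~~ odd alpha) (hbeta_odd : odd beta) (hC : 0 < C).
Variables (u v : R -> R) (T : \bar R).
Hypotheses (hT : (0 < T)%E) (hinit : (u 0, v 0) <> (0, 0)).
Hypothesis hsol : forall t, tint T t ->
     is_derive t 1 u (fieldU alpha beta C (u t) (v t)) /\
     is_derive t 1 v (fieldV alpha beta C (u t) (v t)).

Let q t := u t ^+ 2 + v t ^+ 2.
(** The damping factor: [q' = 2 (F u) q], and the angular velocity is [q^(alpha+beta) + F v]. *)
Let F t := C * (u t ^+ beta * v t ^+ alpha).

Let tint0 : tint T 0. Proof. by split. Qed.

Let dq t : tint T t -> is_derive t 1 q (2 * (F t * u t) * q t).
Proof.
move=> /hsol [du dv].
have := is_derive_fD _ _ _ _ _ _ (is_derive_fM _ _ _ _ _ _ du du)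
  (is_derive_fM _ _ _ _ _ _ dv dv).
move=> d; apply: (is_derive_eq d).
by rewrite /fieldU /fieldV /F /q !exprS; ring.
Qed.

(** [F u = C u^(beta+1) v^alpha] has even exponents only, so [q] is nondecreasing and the trajectory
    never comes closer to the origin than its starting point. *)
Let q_gt0 t : tint T t -> 0 < q t.
Proof.
move=> tT; have : 0 < q 0.
  rewrite lt0r /q addr_ge0 ?sqr_ge0// andbT paddr_eq0 ?sqr_ge0//.
  rewrite !sqrf_eq0; apply/negP => /andP[/eqP u0 /eqP v0].
  by apply: hinit; rewrite u0 v0.
move=> q0; apply: lt_le_trans q0 _.
apply: (derive_ge0_le _ q (fun t => 2 * (F t * u t) * q t) 0 t) => [s /(tint_le _ _ _ _ tT)/dq|s _|]; [exact| |by case: tT].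
apply: mulr_ge0; last by rewrite /q addr_ge0 ?sqr_ge0.
rewrite mulr_ge0// /F -mulrA mulr_ge0 ?(ltW hC)//.
rewrite mulrAC -exprSr mulr_ge0//.
- by rewrite exprn_even_ge0//= hbeta_odd.
- by rewrite exprn_even_ge0.
Qed.

(** The angle is defined as a primitive of the angular velocity [g], its constant fixed by the
    initial point, so no branch of an arctangent has to be followed. It is then checked to be the
    angle: [(P, Q)], the point scaled by [exp(-lam)] and rotated back by [th], has zero derivative
    and starts at [(1, 0)]. *)
Lemma polar_form : exists lam th : R -> R, forall t, tint T t ->
  [/\ u t = expR (lam t) * cos (th t), v t = expR (lam t) * sin (th t),
   is_derive t 1 lam (C * expR (lam t) ^+ (alpha + beta).+1 *
     (cos (th t) ^+ beta.+1 * sin (th t) ^+ alpha)) &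
   is_derive t 1 th (expR (lam t) ^+ (2 * (alpha + beta)) +
     C * expR (lam t) ^+ (alpha + beta).+1 *
     (cos (th t) ^+ beta * sin (th t) ^+ alpha.+1))].
Proof.
pose g t := q t ^+ (alpha + beta) + F t * v t.
have gc t : tint T t -> {for t, continuous g}.
  move=> tT; have [/is_derive_cont cu /is_derive_cont cv] := hsol t tT.
  have /is_derive_cont cq := dq t tT.
  have cX (f : R -> R) m : {for t, continuous f} -> {for t, continuous (fun x => f x ^+ m)}.
    move=> cf; have : {for t, continuous ((fun x => x ^+ m) \o f)}; last by [].
  apply: continuous_comp => //.
    exact: exprn_continuous.
  apply: continuousD; first exact: cX.
  apply: continuousM => //; apply: continuousM; first exact: cst_continuous.
  by apply: continuousM; exact: cX.
have [G dG] := tint_primitive _ _ _ gc.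
pose lam t := 2^-1 * ln (q t).
have elam t : tint T t -> expR (lam t) ^+ 2 = q t.
  by move=> tT; rewrite -expRM_natl /lam mulrA divff ?mul1r ?lnK ?posrE ?q_gt0// pnatr_eq0.
have [psi [u0 v0]] := polar_angle _ _ _ _ (expR_gt0 (lam 0)) (esym (elam 0 tint0)).
pose th t := G t + (psi - G 0).
have dth t : tint T t -> is_derive t 1 th (g t).
  move=> tT; have := is_derive_fD _ _ _ _ _ _ (dG t tT) (is_derive_cst (psi - G 0) t 1).
  by rewrite addr0.
have dlam t : tint T t -> is_derive t 1 lam (F t * u t).
  move=> tT; have q0 := q_gt0 t tT.
  have := is_derive_cM _ _ _ _ 2^-1 (is_derive_ln_comp _ _ _ _ q0 (dq t tT)).
  move=> d; apply: (is_derive_eq d).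
  by field; rewrite gt_eqF.
have dem t : tint T t -> is_derive t 1 (fun x => expR (0 - lam x)) (expR (0 - lam t) * (0 - F t * u t)).
  move=> tT; apply: is_derive_exp_comp.
  exact: is_derive_fB _ _ _ _ _ _ (is_derive_cst 0 t 1) (dlam t tT).
pose P t := expR (0 - lam t) * (u t * cos (th t) + v t * sin (th t)).
pose Q t := expR (0 - lam t) * (v t * cos (th t) - u t * sin (th t)).
have dP t : tint T t -> is_derive t 1 P 0.
  move=> tT; have [du dv] := hsol t tT.
  have dc := is_derive_cos_comp _ _ _ _ (dth t tT).
  have ds := is_derive_sin_comp _ _ _ _ (dth t tT).
  have d := is_derive_fM _ _ _ _ _ _ (dem t tT) (is_derive_fD _ _ _ _ _ _
    (is_derive_fM _ _ _ _ _ _ du dc) (is_derive_fM _ _ _ _ _ _ dv ds)).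
  apply: (is_derive_eq d).
  by rewrite /fieldU /fieldV /g /F /q !exprS; ring.
have dQ t : tint T t -> is_derive t 1 Q 0.
  move=> tT; have [du dv] := hsol t tT.
  have dc := is_derive_cos_comp _ _ _ _ (dth t tT).
  have ds := is_derive_sin_comp _ _ _ _ (dth t tT).
  have d := is_derive_fM _ _ _ _ _ _ (dem t tT) (is_derive_fB _ _ _ _ _ _
    (is_derive_fM _ _ _ _ _ _ dv dc) (is_derive_fM _ _ _ _ _ _ du ds)).
  apply: (is_derive_eq d).
  by rewrite /fieldU /fieldV /g /F /q !exprS; ring.
have th0 : th 0 = psi by rewrite /th; ring.
have P0 : P 0 = 1.
  rewrite /P th0 {1}u0 {1}v0 sub0r -!mulrA -mulrDr -!expr2 cos2Dsin2 mulr1.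
  by rewrite -expRD addNr expR0.
have Q0 : Q 0 = 0 by rewrite /Q th0 {1}u0 {1}v0; ring.
have uv t : tint T t -> u t = expR (lam t) * cos (th t) /\ v t = expR (lam t) * sin (th t).
  move=> tT; have := derive0_const _ _ _ _ dP tT; have := derive0_const _ _ _ _ dQ tT.
  rewrite P0 Q0 /P /Q sub0r expRN => /(congr1 (fun x => expR (lam t) * x)) q1.
  move=> /(congr1 (fun x => expR (lam t) * x)); move: q1.
  have en0 : expR (lam t) != 0 by rewrite gt_eqF// expR_gt0.
  rewrite !mulVKf// mulr0 mulr1 => q1 p1.
  have cs := cos2Dsin2 (th t); rewrite -p1; split; apply/eqP; rewrite -subr_eq0; apply/eqP.
  - transitivity (- sin (th t) * (v t * cos (th t) - u t * sin (th t))).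
      by rewrite -[X in X - _]mulr1 -cs; ring.
    by rewrite q1 mulr0.
  - transitivity (cos (th t) * (v t * cos (th t) - u t * sin (th t))).
      by rewrite -[X in X - _]mulr1 -cs; ring.
    by rewrite q1 mulr0.
exists lam, th => t tT; have [ut vt] := uv t tT; split=> //.
- apply: (is_derive_eq (dlam t tT)).
  by rewrite /F ut vt !exprMn !exprS exprD; ring.
- apply: (is_derive_eq (dth t tT)).
  rewrite /g -(elam t tT) /F ut vt -exprM !exprMn !exprS exprD; ring.
Qed.
End PolarForm.

(** * Area of neighbourhoods *)

(** An open set is the union of the rational boxes that it contains. There are countably many of
    these, and each is measurable for the product structure. *)
Lemma box_open_measurable (R : realType) (A : set (R * R)) :
  (forall p, A p -> exists2 d : R, 0 < d &
     forall q : R * R, `|q.1 - p.1| < d -> `|q.2 - p.2| < d -> A q) ->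
  measurable A.
Proof.
move=> Ao.
pose box (i : rat * rat * (rat * rat)) : set (R * R) :=
  `]ratr i.1.1, ratr i.1.2[ `*` `]ratr i.2.1, ratr i.2.2[.
have -> : A = \bigcup_i (if pselect (box i `<=` A) then box i else set0).
  apply/seteqP; split => [p /Ao [d d0 dA]|p [i _]]; last first.
    by case: pselect => // bA; exact: bA.
  have h (x : R) : exists i j : rat, [/\ x - d < ratr i, ratr i < x, x < ratr j & ratr j < x + d].
    have /rat_in_itvoo [i] : x - d < x by lra.
    have /rat_in_itvoo [j] : x < x + d by lra.
    rewrite !in_itv /= => /andP[j1 j2] /andP[i1 i2]; by exists i, j; split.
  have [a [b [a1 a2 b1 b2]]] := h p.1; have [a' [b' [a3 a4 b3 b4]]] := h p.2.
  have bA : box ((a, b), (a', b')) `<=` A.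
    move=> q [] /=; rewrite !in_itv /= => /andP[q1 q2] /andP[q3 q4].
    by apply: dA; rewrite ltr_norml; apply/andP; split; lra.
  exists ((a, b), (a', b')) => //; case: pselect => // bA'.
  by rewrite /box /=; split; rewrite /= in_itv /=; apply/andP.
apply: countable_bigcupT_measurable => [|i]; first by apply: countableP.
 case: pselect => bA; last exact: measurable0.
  by apply: measurableX; exact: measurable_itv.
Qed.

Lemma measurable_eps_nbhd (R : realType) (B : set (R * R)) (e : R) :
  measurable (eps_nbhd B e).
Proof.
apply: box_open_measurable => p [b Bb pb].
set a := p.1 - b.1 in pb; set c := p.2 - b.2 in pb.
(* For [d <= 1], moving each coordinate by less than [d] raises the squared distance by less than
   [d * M]; [d] is chosen so that this fits in the slack [e^2 - (a^2 + c^2)]. *)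
pose M := 2 * `|a| + 2 * `|c| + 2.
have M0 : 0 < M by rewrite /M; have := normr_ge0 a; have := normr_ge0 c; lra.
pose d := Num.min 1 ((e ^+ 2 - (a ^+ 2 + c ^+ 2)) / M).
have d0 : 0 < d by rewrite lt_min ltr01 divr_gt0// subr_gt0.
have d1 : d <= 1 by rewrite ge_min lexx.
have dM : d * M <= e ^+ 2 - (a ^+ 2 + c ^+ 2).
  by rewrite -ler_pdivlMr// ge_min lexx orbT.
exists d => // q q1 q2; exists b => //.
have -> : q.1 - b.1 = a + (q.1 - p.1) by rewrite /a; ring.
have -> : q.2 - b.2 = c + (q.2 - p.2) by rewrite /c; ring.
have h (x y : R) : `|y| < d -> (x + y) ^+ 2 < x ^+ 2 + d * (2 * `|x| + 1).
  move=> yd; have xy : x * y <= `|x| * `|y| by rewrite -normrM ler_norm.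
  have y2 : y ^+ 2 = `|y| ^+ 2 by rewrite real_normK// num_real.
  by have := normr_ge0 x; have := normr_ge0 y; nra.
by have := h a _ q1; have := h c _ q2; rewrite /M in dM; nra.
Qed.

Lemma le_area (R : realType) (A B : set (R * R)) :
  measurable A -> measurable B -> A `<=` B -> (area A <= area B)%E.
Proof. by move=> mA mB AB; apply: le_measure; rewrite ?inE. Qed.

Lemma area_rect (R : realType) (a b c d : R) : a <= b -> c <= d ->
  area (`[a, b] `*` `[c, d]) = ((b - a) * (d - c))%:E.
Proof.
move=> ab cd.
transitivity (lebesgue_measure (`[a, b] : set R) * lebesgue_measure (`[c, d] : set R))%E.
  by apply: product_measure1E; exact: measurable_itv.
rewrite !lebesgue_measure_itv /= !lte_fin.
move: ab cd; rewrite !le_eqVlt => /orP[/eqP->|ab].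
  by rewrite ltxx mul0e subrr mul0r.
move=> /orP[/eqP->|cd]; first by rewrite ltxx mule0 subrr mulr0.
by rewrite ab cd -!EFinD -EFinM.
Qed.

Lemma area_ge0 (R : realType) (A : set (R * R)) : (0 <= area A)%E.
Proof. exact: measure_ge0. Qed.

Lemma area_setU (R : realType) (A B : set (R * R)) :
  measurable A -> measurable B -> (area (A `|` B) <= area A + area B)%E.
Proof. by move=> mA mB; exact: measureU2. Qed.

Lemma eps_nbhd_close (R : realType) (B : set (R * R)) (e : R) (p : R * R) : 0 < e ->
  eps_nbhd B e p -> exists2 b, B b & `|p.1 - b.1| <= e /\ `|p.2 - b.2| <= e.
Proof.
move=> e0 [b Bb pb]; exists b => //.
have h (x y : R) : x ^+ 2 + y ^+ 2 < e ^+ 2 -> `|x| <= e.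
  move=> xy; rewrite -(@ler_pXn2r _ 2)// ?nnegrE ?normr_ge0 ?(ltW e0)//.
  rewrite real_normK ?num_real//; have := sqr_ge0 y; lra.
by split; apply: h; [exact: pb | rewrite addrC; exact: pb].
Qed.

Lemma area_nbhd_square (R : realType) (B : set (R * R)) (c : R * R) (r e : R) :
  0 <= r -> 0 < e ->
  (forall p, B p -> `|p.1 - c.1| <= r /\ `|p.2 - c.2| <= r) ->
  (area (eps_nbhd B e) <= (4 * (r + e) ^+ 2)%:E)%E.
Proof.
move=> r0 e0 Bc.
have -> : (4 * (r + e) ^+ 2)%:E = area
   (`[c.1 - (r + e), c.1 + (r + e)] `*` `[c.2 - (r + e), c.2 + (r + e)]).
  by rewrite area_rect; [congr (_%:E); ring|lra|lra].
apply: le_area; first exact: measurable_eps_nbhd.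
  by apply: measurableX; exact: measurable_itv.
move=> p /(eps_nbhd_close _ _ _ _ e0) [b /Bc [b1 b2] [p1 p2]].
by split; rewrite /= in_itv /= -ler_distl [r + e]addrC;
  [exact: le_trans (ler_distD b.1 _ _) (lerD p1 b1)
  |exact: le_trans (ler_distD b.2 _ _) (lerD p2 b2)].
Qed.

(* [L] is a chart in which [t |-> (x t, y t)] is 1-Lipschitz; each of [N] windows of length [e] costs one square. *)
Lemma area_nbhd_Lipschitz (R : realType) (x y L : R -> R) (D : set R) (e : R) (N : nat) :
  0 < e ->
  (forall s t, D s -> D t -> `|x t - x s| <= `|L t - L s| /\ `|y t - y s| <= `|L t - L s|) ->
  (forall t, D t -> 0 <= L t < N%:R * e) ->
  (area (eps_nbhd [set (x t, y t) | t in D] e) <= (N%:R * (16 * e ^+ 2))%:E)%E.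
Proof.
move=> e0; elim: N D => [|N IH] D xyL LN.
  have -> : eps_nbhd [set (x t, y t) | t in D] e = set0.
    apply/seteqP; split => // p [b [t Dt _] _].
    by have := LN t Dt; rewrite mul0r; lra.
  by rewrite /area measure0 mul0r.
pose D1 := D `&` [set t | L t < N%:R * e].
pose D2 := D `&` [set t | N%:R * e <= L t].
have A1 : (area (eps_nbhd [set (x t, y t) | t in D1] e) <= (N%:R * (16 * e ^+ 2))%:E)%E.
  apply: IH => [s t [Ds _] [Dt _]|t [Dt Lt]]; first exact: xyL.
  by have /andP[-> _] := LN t Dt.
have A2 : (area (eps_nbhd [set (x t, y t) | t in D2] e) <= (16 * e ^+ 2)%:E)%E.
  have [[s [Ds Ls]]|D20] := pselect (exists s, D2 s); last first.
    have -> : eps_nbhd [set (x t, y t) | t in D2] e = set0.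
      by apply/seteqP; split => // p [b [t Dt _] _]; apply: D20; exists t.
    rewrite /area measure0 lee_fin; have := sqr_ge0 e; lra.
  have -> : 16 * e ^+ 2 = 4 * (e + e) ^+ 2 by ring.
  apply: (@area_nbhd_square _ _ (x s, y s)) => //; first exact: ltW.
  move=> _ [t [Dt Lt] <-] /=.
  have [h1 h2] := xyL s t Ds Dt.
  have : `|L t - L s| <= e.
    rewrite /= in Lt Ls; have /andP[_ Lt'] := LN t Dt; have /andP[_ Ls'] := LN s Ds.
    rewrite -natr1 in Lt' Ls'; rewrite ler_norml; apply/andP; split; lra.
  by move=> h3; split; [exact: le_trans h1 h3|exact: le_trans h2 h3].
apply: (@le_trans _ _ (area (eps_nbhd [set (x t, y t) | t in D1] e `|` eps_nbhd [set (x t, y t) | t in D2] e))).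
  apply: le_area; first exact: measurable_eps_nbhd.
    by apply: measurableU; exact: measurable_eps_nbhd.
  move=> p [b [t Dt <-] pb]; have [Lt|Lt] := ltP (L t) (N%:R * e).
    by left; exists (x t, y t) => //; exists t.
  by right; exists (x t, y t) => //; exists t.
apply: (le_trans (area_setU _ _ _ _ _)); [exact: measurable_eps_nbhd..|].
apply: (le_trans (leeD A1 A2)); rewrite -EFinD lee_fin -natr1; lra.
Qed.

Lemma area_nbhd_Lipschitz_le (R : realType) (x y L : R -> R) (D : set R) (e l : R) :
  0 < e ->
  (forall s t, D s -> D t -> `|x t - x s| <= `|L t - L s| /\ `|y t - y s| <= `|L t - L s|) ->
  0 <= l -> (forall t, D t -> 0 <= L t <= l) ->
  (area (eps_nbhd [set (x t, y t) | t in D] e) <= (16 * e * (l + e))%:E)%E.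
Proof.
move=> e0 xyL l0 Ll; have le0 : 0 <= l / e by rewrite divr_ge0// ltW.
(* The windows are half-open and [L] may reach [l], hence the successor; this extra window is the
   summand [e] in the bound. *)
pose N := (Num.truncn (l / e)).+1.
have N1 : l / e < N%:R by exact: truncnS_gt.
have N2 : N%:R <= l / e + 1 by rewrite /N -natr1 lerD2r truncn_le.
have := @area_nbhd_Lipschitz _ x y L D e N e0 xyL; move=> /(_ _)/le_trans; apply.
  move=> t Dt; have /andP[-> Lt] := Ll t Dt; apply: le_lt_trans Lt _.
  by rewrite -ltr_pdivrMr.
have -> : 16 * e * (l + e) = (l / e + 1) * (16 * e ^+ 2) by field; rewrite gt_eqF.
by rewrite lee_fin ler_wpM2r// mulr_ge0// sqr_ge0.
Qed.

(** * Minkowski contents from area bounds *)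

Section MinkowskiBounds.
Variables (R : realType) (B : set (R * R)).

Lemma mink_ratio_ge0 (s e : R) : (0 <= mink_ratio B s e)%E.
Proof. by rewrite /mink_ratio mule_ge0 ?area_ge0// lee_fin invr_ge0 powR_ge0. Qed.

Lemma upper_mink_le (s d K : R) : 0 < d ->
  (forall e, 0 < e < d -> (mink_ratio B s e <= K%:E)%E) -> (upper_mink s B <= K%:E)%E.
Proof.
move=> d0 h; apply: ge_ereal_inf; eexists; first by exists d.
by apply: ge_ereal_sup => _ [e /= ed <-]; exact: h.
Qed.

Lemma lower_mink_ge (s d c : R) : 0 < d ->
  (forall e, 0 < e < d -> (c%:E <= mink_ratio B s e)%E) -> (c%:E <= lower_mink s B)%E.
Proof.
move=> d0 h; apply: le_ereal_sup_tmp; eexists; first by exists d.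
by apply: le_ereal_inf_tmp => _ [e /= ed <-]; exact: h.
Qed.

Lemma lower_mink_ge0 (s : R) : (0 <= lower_mink s B)%E.
Proof. by apply: (@lower_mink_ge s 1) => // e _; exact: mink_ratio_ge0. Qed.

Lemma le_lower_upper_mink (s : R) : (lower_mink s B <= upper_mink s B)%E.
Proof.
apply: ge_ereal_sup => _ [d1 /= d10 <-]; apply: le_ereal_inf_tmp => _ [d2 /= d20 <-].
(* A scale below both thresholds enters both the infimum and the supremum. *)
pose e := Num.min d1 d2 / 2.
have e0 : 0 < Num.min d1 d2 by rewrite lt_min d10.
have m1 : Num.min d1 d2 <= d1 by rewrite ge_min lexx.
have m2 : Num.min d1 d2 <= d2 by rewrite ge_min lexx orbT.
apply: (@le_trans _ _ (mink_ratio B s e)).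
- by apply: ereal_inf_lbound; exists e => //=; rewrite /e; lra.
- by apply: ereal_sup_ubound; exists e => //=; rewrite /e; lra.
Qed.

Variables (d c K d0 : R).
Hypotheses (hd0 : 0 < d0) (hc : 0 < c).
Hypothesis hB : forall e, 0 < e < d0 ->
  ((c * e `^ (2 - d))%:E <= area (eps_nbhd B e))%E /\
  (area (eps_nbhd B e) <= (K * e `^ (2 - d))%:E)%E.

Let ratio_bounds (s e : R) : 0 < e < d0 ->
  ((c * e `^ (s - d))%:E <= mink_ratio B s e)%E /\
  (mink_ratio B s e <= (K * e `^ (s - d))%:E)%E.
Proof.
move=> ed; have [h1 h2] := hB e ed; have e0 : 0 < e by case/andP: ed.
have E : e `^ (s - d) = e `^ (2 - d) * (e `^ (2 - s))^-1.
  rewrite -powRN -powRD; first by congr (_ `^ _); ring.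
  by apply/implyP => _; rewrite gt_eqF.
have p : (0 <= ((e `^ (2 - s))^-1)%:E)%E by rewrite lee_fin invr_ge0 powR_ge0.
by rewrite E !mulrA !EFinM /mink_ratio; split; apply: lee_wpmul2r.
Qed.

Let K_gt0 : 0 < K.
Proof.
have e0 : 0 < d0 / 2 < d0 by move: hd0 => ?; apply/andP; split; lra.
have [h1 h2] := hB _ e0; have := le_trans h1 h2; rewrite lee_fin.
have p0 : 0 < (d0 / 2) `^ (2 - d) by rewrite powR_gt0//; case/andP: e0.
by rewrite ler_pM2r//; exact: lt_le_trans.
Qed.

Let upper_mink_lt (s : R) : d < s -> upper_mink s B = 0%E.
Proof.
move=> ds; apply/eqP; rewrite eq_le; apply/andP; split; last first.
  exact: le_trans (lower_mink_ge0 s) (le_lower_upper_mink s).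
apply/lee_addgt0Pr => eta eta0; rewrite add0e.
(* The scale at which [K e^(s - d)] equals [eta]. *)
pose d1 := Num.min d0 ((eta / K) `^ (s - d)^-1).
have sd : 0 < s - d by rewrite subr_gt0.
apply: (@upper_mink_le s d1).
  by rewrite lt_min hd0 powR_gt0// divr_gt0.
move=> e /andP[e0]; rewrite lt_min => /andP[ed0 ed1].
have [|_ h] := ratio_bounds s e; first by rewrite e0.
apply: le_trans h _; rewrite lee_fin mulrC -ler_pdivlMr//.
have -> : eta / K = ((eta / K) `^ (s - d)^-1) `^ (s - d).
  rewrite -powRrM mulVf ?gt_eqF// powRr1// ltW// divr_gt0//.
by apply: ge0_ler_powR; rewrite ?nnegrE ?powR_ge0// ltW.
Qed.

Let lower_mink_le (s : R) : s <= d -> (c%:E <= lower_mink s B)%E.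
Proof.
move=> sd; apply: (@lower_mink_ge s (Num.min d0 1)); first by rewrite lt_min hd0 ltr01.
move=> e /andP[e0]; rewrite lt_min => /andP[ed0 ed1].
have [|h _] := ratio_bounds s e; first by rewrite e0.
apply: le_trans h; rewrite lee_fin ler_peMr ?(ltW hc)//.
rewrite -[X in X <= _](powRr0 e); apply: ger_powR; first by rewrite e0 ltW.
by rewrite subr_le0.
Qed.

Let ereal_inf_gt : ereal_inf [set s%:E | s in [set s : R | d < s]] = d%:E.
Proof.
apply/eqP; rewrite eq_le; apply/andP; split.
  apply/lee_addgt0Pr => eta eta0; apply: ereal_inf_lbound; exists (d + eta) => //=.
  by rewrite ltrDl.
by apply: le_ereal_inf_tmp => _ [s /= ds <-]; rewrite lee_fin ltW.
Qed.

(** Both contents vanish exactly for [s > d]: above [d] the ratio is O(e^(s - d)), while for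
    [s <= d] it stays at least [c] at small scales. Both dimensions are thus the infimum of the same
    half-line. *)
Lemma minkowski_of_bounds : upper_box_dim B = d%:E /\ lower_box_dim B = d%:E /\ mink_nondegenerate B.
Proof.
have cpos : (0 < c%:E)%E by rewrite lte_fin.
split; [|split].
- rewrite -ereal_inf_gt /upper_box_dim; congr (ereal_inf [set s%:E | s in _]).
  apply/seteqP; split => s /=; last exact: upper_mink_lt.
  move=> us; rewrite ltNge; apply/negP => /lower_mink_le h.
  by have := le_trans h (le_lower_upper_mink s); rewrite us leNgt cpos.
- rewrite -ereal_inf_gt /lower_box_dim; congr (ereal_inf [set s%:E | s in _]).
  apply/seteqP; split => s /=.
    by move=> us; rewrite ltNge; apply/negP => /lower_mink_le; rewrite us leNgt cpos.
  move=> /upper_mink_lt us; apply/eqP; rewrite eq_le lower_mink_ge0 andbT -us.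
  exact: le_lower_upper_mink.
- exists d; split; first exact: lt_le_trans cpos (lower_mink_le d (lexx d)).
  split; first exact: le_lower_upper_mink.
  apply: (@le_lt_trans _ _ K%:E); last exact: ltry.
  apply: (@upper_mink_le d d0) => // e /(ratio_bounds d) [_].
  by rewrite subrr powRr0 mulr1.
Qed.
End MinkowskiBounds.

(** Since [2 - d = 2 / n], writing the scale as [e^n] turns the real power into [e^2]; the geometric
    estimates then involve integer powers only. *)
Lemma minkowski_of_power_bounds (R : realType) (B : set (R * R)) (n : nat) (c K d0 : R) :
  (0 < n)%N -> 0 < d0 -> 0 < c ->
  (forall e, 0 < e < d0 ->
    ((c * e ^+ 2)%:E <= area (eps_nbhd B (e ^+ n)))%E /\
    (area (eps_nbhd B (e ^+ n)) <= (K * e ^+ 2)%:E)%E) ->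
  let d := 2 * (1 - 1 / n%:R) in
  upper_box_dim B = d%:E /\ lower_box_dim B = d%:E /\ mink_nondegenerate B.
Proof.
move=> n0 d00 c0 hB d.
have nn0 : (n%:R : R) != 0 by rewrite pnatr_eq0 -lt0n.
apply: (@minkowski_of_bounds _ B d c K (d0 ^+ n)) => //; first exact: exprn_gt0.
move=> e /andP[e0 ed]; pose h := e `^ n%:R^-1.
have h0 : 0 < h by rewrite powR_gt0.
have hn : h ^+ n = e by rewrite -powR_mulrn ?ltW// -powRrM mulVf// powRr1// ltW.
have h2 : e `^ (2 - d) = h ^+ 2.
  by rewrite -powR_mulrn ?(ltW h0)// -powRrM; congr (_ `^ _); rewrite /d; field.
have hd : h < d0 by rewrite -hn in ed; rewrite -(@ltr_pXn2r _ n)// nnegrE ltW.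
by have := hB h; rewrite hn h2; apply; rewrite h0.
Qed.

(** * Dynamics in polar coordinates *)

Section TrigBounds.
Variables (R : realType) (alpha beta m : nat).
Hypotheses (halpha_even : ~~ odd alpha) (hbeta_odd : odd beta).
Hypothesis hm : (alpha + beta = m.*2.+1)%N.
Implicit Type t : R.

Definition radial_weight t := cos t ^+ beta.+1 * sin t ^+ alpha.
Definition angular_weight t := cos t ^+ beta * sin t ^+ alpha.+1.

Let even_exp01 (x : R) (j : nat) : `|x| <= 1 -> ~~ odd j -> 0 <= x ^+ j <= 1.
Proof.
move=> x1 j2; rewrite exprn_even_ge0//=.
have -> : x ^+ j = `|x| ^+ j by rewrite -normrX ger0_norm// exprn_even_ge0.
exact: exprn_ile1.
Qed.

Lemma radial_weight_bounds t : 0 <= radial_weight t <= 1.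
Proof.
have /andP[c0 c1] : 0 <= cos t ^+ beta.+1 <= 1.
  by apply: even_exp01; [exact: cos_max|rewrite /= hbeta_odd].
have /andP[s0 s1] := even_exp01 (sin t) alpha (sin_max t) halpha_even.
by rewrite /radial_weight mulr_ge0//= mulr_ile1.
Qed.

(** An odd [beta] is at least 1, so one cosine and one sine can be split off. The perturbation of
    the rotation is therefore small near the axes, exactly where radial growth is too weak to
    compensate for it. *)
Lemma angular_weight_norm_le t : `|angular_weight t| <= `|cos t * sin t|.
Proof.
rewrite /angular_weight !normrM !normrX; case: beta hbeta_odd => // b _.
rewrite !exprSr mulrACA -[leRHS]mul1r.
rewrite ler_wpM2r ?mulr_ge0//.
by apply: mulr_ile1; rewrite ?exprn_ge0 ?exprn_ile1 ?cos_max ?sin_max.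
Qed.

Lemma cos_sin_sqr_le t : (cos t * sin t) ^+ 2 <= 4^-1.
Proof. by have := cos2Dsin2 t; have := sqr_ge0 (cos t ^+ 2 - sin t ^+ 2); nra. Qed.

Lemma angular_weight_norm_le1 t : `|angular_weight t| <= 1.
Proof.
apply: le_trans (angular_weight_norm_le t) _; rewrite normrM mulr_ile1//.
  exact: cos_max.
exact: sin_max.
Qed.

(* The weight dominates (cos sin)^(2m+2), and X^(m+1) >= x0^m (X - x0) for X, x0 >= 0. *)
Lemma radial_weight_ge t (x0 : R) : 0 <= x0 ->
  x0 ^+ m * ((cos t * sin t) ^+ 2 - x0) <= radial_weight t.
Proof.
move=> x00; set X := (_ * _) ^+ 2.
have X0 : 0 <= X by exact: sqr_ge0.
have [/andP[w0 w1]] := radial_weight_bounds t.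
apply: (@le_trans _ _ (X ^+ m * X)).
  have [xX|Xx] := leP x0 X; last first.
    apply: (@le_trans _ _ 0); last by rewrite mulr_ge0// exprn_ge0.
    by rewrite mulr_ge0_le0 ?exprn_ge0// subr_le0 ltW.
  apply: ler_pM; rewrite ?exprn_ge0 ?subr_ge0//; last lra.
  by apply: lerXn2r; rewrite ?nnegrE.
rewrite -exprSr /X -exprM.
(* [(cos sin)^(2m+2)] is the weight times [cos^alpha sin^(beta+1)], a factor in [0, 1]. *)
have -> : (2 * m.+1 = alpha + beta.+1)%N by rewrite addnS hm mul2n doubleS.
have /andP[c0 c1] := even_exp01 (cos t) alpha (cos_max t) halpha_even.
have /andP[s0 s1] : 0 <= sin t ^+ beta.+1 <= 1.
  by apply: even_exp01; [exact: sin_max|rewrite /= hbeta_odd].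
have /andP[w2 w3] : 0 <= cos t ^+ alpha * sin t ^+ beta.+1 <= 1.
  by rewrite mulr_ge0//= mulr_ile1.
rewrite exprMn !exprD.
have -> : cos t ^+ alpha * cos t ^+ beta.+1 * (sin t ^+ alpha * sin t ^+ beta.+1) =
  radial_weight t * (cos t ^+ alpha * sin t ^+ beta.+1) by rewrite /radial_weight; ring.
by nra.
Qed.
End TrigBounds.

(** This is [sin(4t)/4]. Its derivative [cos(4t) = 1 - 8 (cos t sin t)^2] is 1 on the axes and
    negative only away from them, where the radial weight can make up for it. *)
Definition quad_angle (R : realType) (t : R) := cos t * sin t * (cos t * cos t - sin t * sin t).

Lemma quad_angle_norm_le (R : realType) (t : R) : `|quad_angle R t| <= 1.
Proof.
have c1 := cos_max t; have s1 := sin_max t; have cs := cos2Dsin2 t.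
rewrite /quad_angle !normrM.
have h : `|cos t * cos t - sin t * sin t| <= 1.
  by rewrite ler_norml; apply/andP; split; nra.
have : `|cos t| * `|sin t| <= 1 by rewrite mulr_ile1.
by move=> h2; rewrite mulr_ile1// mulr_ge0.
Qed.

Lemma is_derive_quad_angle (R : realType) (f : R -> R) (t a : R) :
  is_derive t 1 f a ->
  is_derive t 1 (fun x => quad_angle R (f x)) ((1 - 8 * (cos (f t) * sin (f t)) ^+ 2) * a).
Proof.
move=> fa.
have dc := is_derive_cos_comp _ _ _ _ fa; have ds := is_derive_sin_comp _ _ _ _ fa.
have d := is_derive_fM _ _ _ _ _ _ (is_derive_fM _ _ _ _ _ _ dc ds)
  (is_derive_fB _ _ _ _ _ _ (is_derive_fM _ _ _ _ _ _ dc dc) (is_derive_fM _ _ _ _ _ _ ds ds)).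
apply: (is_derive_eq d).
have -> : 1 - 8 * (cos (f t) * sin (f t)) ^+ 2 =
  (cos (f t) ^+ 2 + sin (f t) ^+ 2) ^+ 2 - 8 * (cos (f t) * sin (f t)) ^+ 2.
  by rewrite cos2Dsin2 expr1n.
by ring.
Qed.

Section PolarDynamics.
(** With [n = alpha + beta], the application takes [k = n - 2]; [m] is [(n - 1)/2]. *)
Variables (R : realType) (alpha beta k m : nat) (C : R).
Hypotheses (halpha_even : ~~ odd alpha) (hbeta_odd : odd beta) (hC : 0 < C).
Hypothesis hm : (alpha + beta = m.*2.+1)%N.
Variables (lam th : R -> R) (T : \bar R).

Let E t := expR (lam t).
(* With [Y = E^(n-1)], every power of [E] in the polar system is a monomial in [Y] and [E]. *)
Let Y t := E t ^+ k.+1.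
Let A t := radial_weight _ alpha beta (th t).
Let W t := angular_weight _ alpha beta (th t).
Let X t := (cos (th t) * sin (th t)) ^+ 2.

Hypothesis dlam : forall t, tint T t -> is_derive t 1 lam (C * (Y t * E t ^+ 2) * A t).
Hypothesis dth : forall t, tint T t ->
  is_derive t 1 th (Y t ^+ 2 * E t ^+ 2 + C * (Y t * E t ^+ 2) * W t).

Let E_gt0 t : 0 < E t. Proof. exact: expR_gt0. Qed.
Let Y_gt0 t : 0 < Y t. Proof. exact: exprn_gt0. Qed.
Let Q_gt0 t : 0 < C * (Y t * E t ^+ 2).
Proof. by apply: mulr_gt0 => //; apply: mulr_gt0; [exact: Y_gt0 | exact: exprn_gt0]. Qed.
Let A_ge0 t : 0 <= A t. Proof. by case/andP: (radial_weight_bounds _ _ _ halpha_even hbeta_odd (th t)). Qed.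
Let A_le1 t : A t <= 1. Proof. by case/andP: (radial_weight_bounds _ _ _ halpha_even hbeta_odd (th t)). Qed.
Let W_le1 t : `|W t| <= 1. Proof. exact: angular_weight_norm_le1. Qed.
Let X_ge0 t : 0 <= X t. Proof. exact: sqr_ge0. Qed.
Let X_le t : X t <= 4^-1. Proof. exact: cos_sin_sqr_le. Qed.
Let A_ge t (x0 : R) : 0 <= x0 -> x0 ^+ m * (X t - x0) <= A t.
Proof. exact: radial_weight_ge. Qed.

Lemma lam_nondecreasing (s t : R) : tint T t -> 0 <= s -> s <= t -> lam s <= lam t.
Proof.
move=> tT s0 st; apply: (derive_ge0_le _ lam (fun t => C * (Y t * E t ^+ 2) * A t) s t _ _ st) => r /andP[sr rt].
  by apply: dlam; apply: tint_le tT _; rewrite rt (le_trans s0 sr).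
exact: mulr_ge0 (ltW (Q_gt0 r)) (A_ge0 r).
Qed.

Let E_le (s t : R) : tint T t -> 0 <= s -> s <= t -> E s <= E t.
Proof. by move=> tT s0 st; rewrite ler_expR lam_nondecreasing. Qed.

(* [K lam + sin(4 th)/4] has derivative bounded below as long as [E] stays bounded:
   [lam] grows away from the axes, the sine term grows near them. *)
Lemma lam_unbounded (M : R) : T = +oo%E -> exists2 t, tint T t & M < lam t.
Proof.
move=> Ty; apply/not_exists2P => H.
have {}H (t : R) : 0 <= t -> lam t <= M.
  move=> t0; have [|] := H t; first by case; rewrite /tint /= Ty; split=> //; rewrite ltry.
  by move/negP; rewrite -leNgt.
have tT (t : R) : 0 <= t -> tint T t by move=> t0; rewrite Ty; split=> //; rewrite ltry.
pose w0 := E 0; pose w1 := expR M.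
have Ew (t : R) : 0 <= t -> w0 <= E t <= w1.
  move=> t0; apply/andP; split; first exact: (E_le _ _ (tT _ t0) (lexx 0) t0).
  by rewrite /E /w1 ler_expR; exact: H.
have w00 : 0 < w0 by exact: E_gt0.
have w10 : 0 < w1 by exact: expR_gt0.
(* If [lam] never exceeds [M], the two terms of the angular velocity satisfy [p0 <= Y^2 E^2 <= p1]
   and [r0 <= C Y E^2 <= r1]. *)
pose p0 := (w0 ^+ k.+1) ^+ 2 * w0 ^+ 2; pose p1 := (w1 ^+ k.+1) ^+ 2 * w1 ^+ 2.
pose r0 := C * (w0 ^+ k.+1 * w0 ^+ 2); pose r1 := C * (w1 ^+ k.+1 * w1 ^+ 2).
have p00 : 0 < p0 by rewrite /p0 mulr_gt0 ?exprn_gt0.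
have p10 : 0 < p1 by rewrite /p1 mulr_gt0 ?exprn_gt0.
have r00 : 0 < r0 by rewrite /r0 !mulr_gt0 ?exprn_gt0.
have r10 : 0 < r1 by rewrite /r1 !mulr_gt0 ?exprn_gt0.
(* The coefficient of [X] to be absorbed: [8 p1] from [1 - 8 X], and [r1^2 / p0] from the angular
   perturbation after completing a square. Then [x0] gives [c6 x0 = p0/4], and [K] makes the radial
   term at least [c6 X - p0/4]. *)
pose c6 := 8 * p1 + r1 ^+ 2 / p0.
have c60 : 0 < c6.
  by apply: ltr_pwDl; [exact: mulr_gt0 | apply: divr_ge0; [exact: sqr_ge0 | exact: ltW]].
pose x0 := p0 / (4 * c6).
have x00 : 0 < x0 by apply: divr_gt0 => //; exact: mulr_gt0.
have q0 : 0 < r0 * x0 ^+ m by rewrite mulr_gt0// exprn_gt0.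
pose K := c6 / (r0 * x0 ^+ m).
(* Of the main term [p0], the radial estimate and the completed square each cost [p0/4]; the
   remaining [p0/2] is the linear growth rate subtracted here. *)
pose f t := K * lam t + quad_angle _ (th t) - p0 / 2 * t.
have df (t : R) : 0 <= t -> is_derive t 1 f
    (K * (C * (Y t * E t ^+ 2) * A t) +
     (1 - 8 * X t) * (Y t ^+ 2 * E t ^+ 2 + C * (Y t * E t ^+ 2) * W t) - p0 / 2 * 1).
  move=> /tT t0; exact: (is_derive_fB _ _ _ _ _ _ (is_derive_fD _ _ _ _ _ _
    (is_derive_cM _ _ _ _ _ (dlam t t0)) (is_derive_quad_angle _ _ _ _ (dth t t0)))
    (is_derive_cM _ id _ _ _ (is_derive_id t 1))).
have f_incr (t : R) : 0 <= t -> f 0 <= f t.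
  move=> t0; apply: (derive_ge0_le _ f (fun t => K * (C * (Y t * E t ^+ 2) * A t) +
     (1 - 8 * X t) * (Y t ^+ 2 * E t ^+ 2 + C * (Y t * E t ^+ 2) * W t) - p0 / 2 * 1)
     0 t _ _ t0) => s /andP[s0 _]; first exact: df.
  have /andP[e0 e1] := Ew s s0.
  have pw (i : nat) (x y : R) : 0 <= x -> x <= y -> x ^+ i <= y ^+ i.
    by move=> xp xy; apply: lerXn2r; rewrite ?nnegrE// (le_trans xp).
  have Es := ltW (E_gt0 s); have Ys := ltW (Y_gt0 s).
  have w0p (i : nat) : 0 <= w0 ^+ i by rewrite exprn_ge0// ltW.
  have Yl : w0 ^+ k.+1 <= Y s by apply: pw => //; exact: ltW.
  have Yu : Y s <= w1 ^+ k.+1 by exact: pw.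
  have El : w0 ^+ 2 <= E s ^+ 2 by apply: pw => //; exact: ltW.
  have Eu : E s ^+ 2 <= w1 ^+ 2 by exact: pw.
  have h1 : p0 <= Y s ^+ 2 * E s ^+ 2 <= p1.
    apply/andP; split.
      by apply: ler_pM => //; [exact: sqr_ge0 | exact: pw].
    by apply: ler_pM => //; [exact: sqr_ge0 | exact: sqr_ge0 | exact: pw].
  have h2 : r0 <= C * (Y s * E s ^+ 2) <= r1.
    apply/andP; split; rewrite /r0 /r1 ler_pM2l//.
      exact: ler_pM.
    by apply: ler_pM => //; exact: sqr_ge0.
  move: (Y s ^+ 2 * E s ^+ 2) (C * (Y s * E s ^+ 2)) h1 h2 => P Q /andP[P0 P1] /andP[Q0 Q1].
  have X0 := X_ge0 s; have X1 := X_le s; have A0 := A_ge0 s.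
  have hA : c6 * X s - p0 / 4 <= K * (Q * A s).
    apply: (@le_trans _ _ (K * (r0 * A s))); last first.
      by rewrite ler_pM2l ?divr_gt0// ler_wpM2r.
    apply: (@le_trans _ _ (K * (r0 * (x0 ^+ m * (X s - x0))))); last first.
      by rewrite ler_pM2l ?divr_gt0// ler_pM2l// A_ge// ltW.
    have e : c6 * x0 = p0 / 4 by rewrite /x0; field; rewrite gt_eqF.
    rewrite [r0 * (_ * _)]mulrA mulrA /K divfK ?(gt_eqF q0)//; lra.
  have hW : r1 * `|W s| <= p0 / 4 + r1 ^+ 2 / p0 * X s.
    have -> : X s = `|cos (th s) * sin (th s)| ^+ 2 by rewrite real_normK// num_real.
    apply: (@le_trans _ _ (r1 * `|cos (th s) * sin (th s)|)).
      by rewrite ler_pM2l// angular_weight_norm_le.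
    move: `|cos (th s) * sin (th s)| => y.
    rewrite -subr_ge0.
    have -> : p0 / 4 + r1 ^+ 2 / p0 * y ^+ 2 - r1 * y = (p0 / 2 - r1 * y) ^+ 2 / p0.
      by field; rewrite gt_eqF.
    by rewrite divr_ge0 ?sqr_ge0 ?ltW.
  have hS : p0 - 8 * p1 * X s - r1 * `|W s| <= (1 - 8 * X s) * (P + Q * W s).
    have h3 : (1 - 8 * X s) * (Q * W s) >= - (r1 * `|W s|).
      have h4 : `|(1 - 8 * X s) * (Q * W s)| <= r1 * `|W s|.
        rewrite normrM normrM; apply: (@le_trans _ _ (1 * (Q * `|W s|))).
          apply: ler_pM; [exact: normr_ge0 | by rewrite mulr_ge0 | | ].
            by rewrite ler_norml; apply/andP; split; lra.
          by rewrite ger0_norm//; lra.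
        by rewrite mul1r ler_wpM2r.
      by have := ler_norm (- ((1 - 8 * X s) * (Q * W s))); rewrite normrN; lra.
    have h5 : P * X s <= p1 * X s by rewrite ler_wpM2r.
    nra.
  rewrite /c6 in hA; lra.
(* [K lam] is at most [K M] and the oscillating term at most 1, so the linear function [p0/2 * t]
   would be bounded. *)
have [c hc] : exists c, forall t, 0 <= t -> p0 / 2 * t <= c.
  exists (K * M + 1 - f 0) => t t0; have := f_incr t t0; rewrite {2}/f.
  have := quad_angle_norm_le _ (th t); rewrite ler_norml => /andP[_ s1].
  have : K * lam t <= K * M by rewrite ler_pM2l ?divr_gt0// H.
  lra.
have := hc ((`|c| + 1) / (p0 / 2)).
have -> : p0 / 2 * ((`|c| + 1) / (p0 / 2)) = `|c| + 1 by field; rewrite gt_eqF.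
have c0 := normr_ge0 c; have := ler_norm c.
have h : 0 <= (`|c| + 1) / (p0 / 2) by rewrite divr_ge0 ?divr_ge0 ?ltW//; lra.
by move=> ? /(_ h); lra.
Qed.

Let dEX (j : nat) (t : R) : tint T t ->
  is_derive t 1 (fun x => E x ^+ j) (E t ^+ j * (j%:R * (C * (Y t * E t ^+ 2) * A t))).
Proof.
move=> tT; rewrite /E.
have -> : (fun x => expR (lam x) ^+ j) = (fun x => expR (j%:R * lam x)).
  by apply/funext => x; rewrite expRM_natl.
rewrite -expRM_natl.
exact: is_derive_exp_comp _ _ _ _ (is_derive_cM _ _ _ _ _ (dlam t tT)).
Qed.

(** * Rotation in the regime of large [E] *)

Hypothesis E_unbounded : forall M : R, exists2 t, tint T t & M < E t.
Variable t1 : R.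
(** From [t1] on, [E >= 1] yields [Y >= E >= 8 C], so the perturbation of the angular velocity is at
    most one eighth of its main term. *)
Hypotheses (t1T : tint T t1) (E_t1 : 8 * C + 1 <= E t1).

Let t1_ge0 : 0 <= t1. Proof. by case: t1T. Qed.

Let late_bounds (t : R) : tint T t -> t1 <= t -> [/\ 1 <= E t, E t <= Y t & 8 * C <= Y t].
Proof.
move=> tT tt1; have := E_le _ _ tT t1_ge0 tt1 => Ett.
have E1 : 1 <= E t by move: hC E_t1; lra.
have EY : E t <= Y t by rewrite /Y exprS ler_peMr ?exprn_ege1// ltW// E_gt0.
by split=> //; move: E_t1; lra.
Qed.

Let dth_bounds (t : R) : tint T t -> t1 <= t ->
  Y t ^+ 2 * E t ^+ 2 / 2 <= Y t ^+ 2 * E t ^+ 2 + C * (Y t * E t ^+ 2) * W t.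
Proof.
move=> tT tt1; have [E1 EY CY] := late_bounds _ tT tt1.
have := W_le1 t; rewrite ler_norml => /andP[W0 _].
have := Q_gt0 t => Q0.
have h : 8 * (C * (Y t * E t ^+ 2)) <= Y t ^+ 2 * E t ^+ 2.
  have -> : 8 * (C * (Y t * E t ^+ 2)) = (8 * C) * (Y t * E t ^+ 2) by ring.
  have -> : Y t ^+ 2 * E t ^+ 2 = Y t * (Y t * E t ^+ 2) by ring.
  by apply: ler_wpM2r => //; apply: mulr_ge0; [exact: ltW | exact: sqr_ge0].
by nra.
Qed.

Lemma th_increasing (s t : R) : tint T t -> t1 <= s -> s < t -> th s < th t.
Proof.
move=> tT ts st.
apply: (derive_gt0_lt _ th (fun t => Y t ^+ 2 * E t ^+ 2 + C * (Y t * E t ^+ 2) * W t) s t _ _ st).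
  move=> r /andP[sr rt]; apply: dth; apply: tint_le tT _; rewrite rt andbT.
  exact: le_trans t1_ge0 (le_trans ts sr).
move=> r /andP[sr rt]; have rT : tint T r.
  by apply: tint_le tT _; rewrite rt andbT (le_trans t1_ge0)// (le_trans ts).
apply: lt_le_trans (dth_bounds _ rT (le_trans ts sr)).
by apply: divr_gt0 => //; apply: mulr_gt0; apply: exprn_gt0; [exact: Y_gt0|exact: E_gt0].
Qed.

(** [Y' <= (k+1) C Y^2 E^2] while [th' >= Y^2 E^2 / 2]: [Y] grows at most linearly in the angle. *)
Let th_growth (t : R) : tint T t -> t1 <= t ->
  Y t - Y t1 <= 2 * k.+1%:R * C * (th t - th t1).
Proof.
move=> tT tt1; pose c := 2 * k.+1%:R * C.
have c0 : 0 <= c by rewrite /c !mulr_ge0// ltW.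
suff : c * th t1 - Y t1 <= c * th t - Y t by rewrite -/c; lra.
apply: (derive_ge0_le _ (fun x => c * th x - Y x)
  (fun t => c * (Y t ^+ 2 * E t ^+ 2 + C * (Y t * E t ^+ 2) * W t) -
     Y t * (k.+1%:R * (C * (Y t * E t ^+ 2) * A t))) t1 t _ _ tt1) => r /andP[sr rt].
  have rT : tint T r by apply: tint_le tT _; rewrite rt andbT (le_trans t1_ge0).
  exact: is_derive_fB _ _ _ _ _ _ (is_derive_cM _ _ _ _ _ (dth r rT)) (dEX k.+1 r rT).
have rT : tint T r by apply: tint_le tT _; rewrite rt andbT (le_trans t1_ge0).
have h := ler_wpM2l c0 (dth_bounds _ rT sr).
have : Y r * (k.+1%:R * (C * (Y r * E r ^+ 2) * A r)) <= c * (Y r ^+ 2 * E r ^+ 2 / 2).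
  have -> : Y r * (k.+1%:R * (C * (Y r * E r ^+ 2) * A r)) =
    (k.+1%:R * C * (Y r ^+ 2 * E r ^+ 2)) * A r by ring.
  have -> : c * (Y r ^+ 2 * E r ^+ 2 / 2) = k.+1%:R * C * (Y r ^+ 2 * E r ^+ 2).
    by rewrite /c; field.
  rewrite ler_piMr//; apply: mulr_ge0; last by apply: mulr_ge0; exact: sqr_ge0.
  by apply: mulr_ge0 => //; exact: ltW.
by lra.
Qed.

(** Since [E <= Y], unboundedness of [E] passes to the angle through [th_growth]. The argument is
    the same for infinite [T] and for blow-up in finite time. *)
Lemma th_tends_to_infty : tends_to_pinfty th T.
Proof.
move=> M; pose c := 2 * k.+1%:R * C.
have c0 : 0 < c by rewrite /c !mulr_gt0.
have [s sT hs] := E_unbounded (Y t1 + c * (M - th t1)).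
exists (Num.max s t1) => [|t tT]; first by rewrite maxEle; case: ifP.
rewrite ge_max => /andP[st tt1].
have [_ EY _] := late_bounds _ tT tt1.
have s0 : 0 <= s by case: sT.
have := E_le _ _ tT s0 st; have := th_growth _ tT tt1; rewrite -/c => h1 h2.
have : c * (M - th t1) < c * (th t - th t1) by lra.
by rewrite ltr_pM2l// ltrD2r.
Qed.

Let ds (t : R) : tint T t ->
  is_derive t 1 (fun x => expR (- lam x)) (expR (- lam t) * (- (C * (Y t * E t ^+ 2) * A t))).
Proof. by move=> tT; exact: is_derive_exp_comp _ _ _ _ (is_deriveN (dlam t tT)). Qed.

Let sE (t : R) : expR (- lam t) * E t = 1.
Proof. by rewrite /E -expRD addNr expR0. Qed.

(* Along a full turn starting on the circle of radius [r], the radius drops by O(r^n). *)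
Lemma spiral_visits_direction (r phi : R) : 0 < r -> r * E t1 <= 1 ->
  exists2 t, tint T t & [/\ cos (th t) = cos phi, sin (th t) = sin phi &
    0 <= r - expR (- lam t) <= 4 * pi * C * r ^+ k.+2].
Proof.
move=> r0 rE.
(* The time at which the inverted curve has radius [r]; [r * E t1 <= 1] places it after [t1]. *)
have [tr [trT t1tr Etr]] : exists tr, [/\ tint T tr, t1 <= tr & E tr = r^-1].
  have [t2 t2T rt2] := E_unbounded r^-1.
  have E1r : E t1 <= r^-1 by rewrite -[r^-1]mul1r ler_pdivlMr// mulrC.
  have t12 : t1 <= t2.
    rewrite leNgt; apply/negP => t21; have t20 : 0 <= t2 by case: t2T.
    by have := E_le _ _ t1T t20 (ltW t21); lra.
  have dE (t : R) : t1 <= t <= t2 -> is_derive t 1 E (E t * (C * (Y t * E t ^+ 2) * A t)).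
    move=> /andP[h1 h2]; apply: is_derive_exp_comp; apply: dlam.
    by apply: tint_le t2T _; rewrite h2 (le_trans t1_ge0).
  have [|c /andP[c1 c2] Ec] := @derive_IVT _ E _ t1 t2 r^-1 dE t12.
    by rewrite E1r ltW.
  by exists c; split=> //; apply: tint_le t2T _; rewrite c2 (le_trans t1_ge0).
have [psi [psi1 psi2 cpsi spsi]] := angle_window _ phi (th tr).
have [tb tbT hb] := th_tends_to_infty psi.
pose t3 := Num.max tr tb.
have t3T : tint T t3 by rewrite /t3 maxEle; case: ifP.
have trt3 : tr <= t3 by rewrite le_max lexx.
have tr0 : 0 <= tr by case: trT.
have t3le (t : R) : tr <= t <= t3 -> tint T t.
  by move=> /andP[h1 h2]; apply: tint_le t3T _; rewrite h2 (le_trans tr0).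
have [||t /andP[trt tt3] tht] := @derive_IVT _ th
    (fun t => Y t ^+ 2 * E t ^+ 2 + C * (Y t * E t ^+ 2) * W t) tr t3 psi _ trt3.
- by move=> t /t3le; exact: dth.
- by rewrite psi1 ltW// hb// le_max lexx orbT.
have tT : tint T t by apply: t3le; rewrite trt.
exists t => //; rewrite tht cpsi spsi; split=> //.
have str : expR (- lam tr) = r by rewrite expRN -/(E tr) Etr invrK.
apply/andP; split.
  rewrite subr_ge0 -str ler_expR lerN2; exact: lam_nondecreasing tT tr0 trt.
(* After [tr], [r E >= 1] and so [r^(k+2) Y E >= 1]. With this [c], the gain [c th'] covers the loss
   of inverted radius, which has rate at most [C Y E]; one turn then costs at most [2 pi c]. *)
pose c := 2 * C * r ^+ k.+2.
have c0 : 0 <= c.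
  by apply: mulr_ge0; [apply: mulr_ge0 => //; exact: ltW | apply: exprn_ge0; exact: ltW].
have : expR (- lam tr) + c * th tr <= expR (- lam t) + c * th t.
  apply: (derive_ge0_le _ (fun x => expR (- lam x) + c * th x)
    (fun t => expR (- lam t) * (- (C * (Y t * E t ^+ 2) * A t)) +
     c * (Y t ^+ 2 * E t ^+ 2 + C * (Y t * E t ^+ 2) * W t)) tr t _ _ trt) => q /andP[trq qt].
    have qT : tint T q by apply: tint_le tT _; rewrite qt (le_trans tr0).
    exact: is_derive_fD _ _ _ _ _ _ (ds q qT) (is_derive_cM _ _ _ _ _ (dth q qT)).
  have qT : tint T q by apply: tint_le tT _; rewrite qt (le_trans tr0).
  have h := ler_wpM2l c0 (dth_bounds _ qT (le_trans t1tr trq)).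
  have -> : expR (- lam q) * - (C * (Y q * E q ^+ 2) * A q) =
    - ((expR (- lam q) * E q) * (C * (Y q * E q)) * A q) by ring.
  rewrite sE mul1r.
  have rEq : 1 <= r ^+ k.+2 * (Y q * E q).
    rewrite /Y -exprSr -exprMn exprn_ege1//.
    have := E_le _ _ qT tr0 trq; rewrite Etr => /(ler_wpM2l (ltW r0)).
    by rewrite divff// gt_eqF.
  have YE : 0 < C * (Y q * E q).
    by apply: mulr_gt0 => //; apply: mulr_gt0; [exact: Y_gt0 | exact: E_gt0].
  have e : c * (Y q ^+ 2 * E q ^+ 2 / 2) = C * (Y q * E q) * (r ^+ k.+2 * (Y q * E q)).
    by rewrite /c; field.
  have := ler_wpM2l (ltW YE) rEq; rewrite -e mulr1 => h2.
  have : C * (Y q * E q) * A q <= C * (Y q * E q) by apply: ler_piMr => //; exact: ltW.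
  by lra.
rewrite str tht => h.
have : c * (psi - th tr) <= c * (2 * pi) by rewrite ler_wpM2l//; lra.
by rewrite /c in h *; lra.
Qed.

(** * Area around the inverted trajectory [Gamma]: lower bound *)

Let Gamma := [set (expR (- lam t) * cos (th t), expR (- lam t) * sin (th t)) | t in tint T].

(** Near the origin the spiral passes close to every point, in that point's own direction. A square
    with sides [[r0/4, r0/2]] replaces the punctured disk: it avoids the origin and its area is
    explicit. *)
Lemma area_spiral_ge (e : R) : 0 < e -> e * E t1 <= 1 ->
  (((4 * (4 * pi * C + 1))^-1 ^+ 2 * e ^+ 2)%:E <= area (eps_nbhd Gamma (e ^+ k.+2)))%E.
Proof.
(* As [rho > 1], a radius [r <= e / rho] gives [4 pi C r^(k+2) < rho r^(k+2) <= (rho r)^(k+2) <=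
   e^(k+2)]. *)
move=> e0 eE; pose rho := 4 * pi * C + 1.
have pC : 0 < 4 * pi * C by rewrite !mulr_gt0 ?pi_gt0.
have rho1 : 1 < rho by rewrite /rho ltrDr.
have rho0 : 0 < rho by apply: lt_trans rho1.
pose r0 := e / rho.
have r00 : 0 < r0 by rewrite divr_gt0.
have r0e : r0 < e by rewrite /r0 ltr_pdivrMr// ltr_pMr.
have -> : (4 * (4 * pi * C + 1))^-1 ^+ 2 * e ^+ 2 = (r0 / 2 - r0 / 4) * (r0 / 2 - r0 / 4).
  by rewrite /r0 -/rho; field; rewrite gt_eqF.
rewrite -area_rect; [|lra|lra].
apply: le_area; [|exact: measurable_eps_nbhd|].
  by apply: measurableX; exact: measurable_itv.
move=> p [] /=; rewrite !in_itv /= => /andP[a1 a2] /andP[b1 b2].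
pose r := Num.sqrt (p.1 ^+ 2 + p.2 ^+ 2).
have p0 : 0 < p.1 ^+ 2 + p.2 ^+ 2 by nra.
have r_gt0 : 0 < r by rewrite sqrtr_gt0.
have r2 : p.1 ^+ 2 + p.2 ^+ 2 = r ^+ 2 by rewrite sqr_sqrtr// ltW.
have rr0 : r <= r0.
  by rewrite -(@ler_pXn2r _ 2)// ?nnegrE ?ltW// -r2; nra.
have [phi [p1 p2]] := polar_angle _ _ _ _ r_gt0 r2.
have [|t tT [ct st /andP[d0 d1]]] := spiral_visits_direction r phi r_gt0.
  by apply: le_trans eE; rewrite ler_wpM2r ?ltW ?E_gt0// (le_lt_trans rr0).
exists (expR (- lam t) * cos (th t), expR (- lam t) * sin (th t)); first by exists t.
rewrite /= ct st p1 p2; move: (expR (- lam t)) d0 d1 => s d0 d1.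
have -> : (r * cos phi - s * cos phi) ^+ 2 + (r * sin phi - s * sin phi) ^+ 2 =
  (r - s) ^+ 2 * (cos phi ^+ 2 + sin phi ^+ 2) by ring.
rewrite cos2Dsin2 mulr1.
rewrite ltr_pXn2r ?nnegrE ?exprn_ge0 ?(ltW e0)//.
apply: le_lt_trans d1 _.
have rk : r ^+ k.+2 * rho <= e ^+ k.+2.
  apply: (@le_trans _ _ ((r0 * rho) ^+ k.+2)); last by rewrite /r0 divfK// gt_eqF.
  rewrite exprMn; apply: ler_pM; rewrite ?exprn_ge0 ?(ltW r_gt0) ?(ltW rho0)//.
    by apply: lerXn2r; rewrite ?nnegrE ?(ltW r_gt0) ?(ltW r00).
  by rewrite exprS ler_peMr ?exprn_ege1 ?(ltW rho0) ?(ltW rho1).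
apply: lt_le_trans rk; rewrite mulrC ltr_pM2l ?exprn_gt0//.
by rewrite /rho; lra.
Qed.

(** * Speed, arc length and the upper area bound *)

Let speed (t : R) := Y t ^+ 2 * E t + 2 * (C * (Y t * E t)).

Let vx (t : R) := expR (- lam t) * - (C * (Y t * E t ^+ 2) * A t) * cos (th t) +
  expR (- lam t) * (- sin (th t) * (Y t ^+ 2 * E t ^+ 2 + C * (Y t * E t ^+ 2) * W t)).
Let vy (t : R) := expR (- lam t) * - (C * (Y t * E t ^+ 2) * A t) * sin (th t) +
  expR (- lam t) * (cos (th t) * (Y t ^+ 2 * E t ^+ 2 + C * (Y t * E t ^+ 2) * W t)).

Let dx (t : R) : tint T t -> is_derive t 1 (fun x => expR (- lam x) * cos (th x)) (vx t).
Proof.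
by move=> tT; exact: is_derive_fM _ _ _ _ _ _ (ds t tT) (is_derive_cos_comp _ _ _ _ (dth t tT)).
Qed.

Let dy (t : R) : tint T t -> is_derive t 1 (fun x => expR (- lam x) * sin (th x)) (vy t).
Proof.
by move=> tT; exact: is_derive_fM _ _ _ _ _ _ (ds t tT) (is_derive_sin_comp _ _ _ _ (dth t tT)).
Qed.

Let CYE_gt0 (t : R) : 0 < C * (Y t * E t).
Proof. by apply: mulr_gt0 => //; apply: mulr_gt0; [exact: Y_gt0 | exact: E_gt0]. Qed.

(** Treats both coordinates at once, [(a, b)] being [(cos, -sin)] or [(sin, cos)]. The radial part
    contributes at most [C Y E], the tangential part at most [Y^2 E + C Y E]. *)
Let velocity_le (a b t : R) : `|a| <= 1 -> `|b| <= 1 ->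
  `|expR (- lam t) * - (C * (Y t * E t ^+ 2) * A t) * a +
    expR (- lam t) * (b * (Y t ^+ 2 * E t ^+ 2 + C * (Y t * E t ^+ 2) * W t))| <= speed t.
Proof.
move=> a1 b1.
have -> : expR (- lam t) * - (C * (Y t * E t ^+ 2) * A t) * a +
    expR (- lam t) * (b * (Y t ^+ 2 * E t ^+ 2 + C * (Y t * E t ^+ 2) * W t)) =
  (expR (- lam t) * E t) * (b * (Y t ^+ 2 * E t + C * (Y t * E t) * W t) -
     a * (C * (Y t * E t) * A t)) by ring.
rewrite sE mul1r /speed.
have Q0 := CYE_gt0 t; move: (C * _) Q0 => Q Q0.
have P0 : 0 <= Y t ^+ 2 * E t by apply: mulr_ge0; [exact: sqr_ge0 | exact: ltW].
move: (Y t ^+ 2 * E t) P0 => P P0.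
have cut (c d : R) : `|c| <= 1 -> `|c * d| <= `|d|.
  by move=> c1; rewrite normrM -[leRHS]mul1r ler_wpM2r.
apply: le_trans (ler_normB _ _) _.
have h1 := cut a (Q * A t) a1; have h2 := cut b (P + Q * W t) b1.
have h3 : `|Q * A t| <= Q by rewrite ger0_norm ?(mulr_ge0 (ltW Q0) (A_ge0 t))// ler_piMr// ltW.
have h4 : `|P + Q * W t| <= P + Q.
  apply: le_trans (ler_normD _ _) _; rewrite (ger0_norm P0) normrM (ger0_norm (ltW Q0)).
  by rewrite lerD2l ler_piMr// ltW.
by lra.
Qed.

Let vx_le (t : R) : `|vx t| <= speed t.
Proof. by apply: velocity_le; rewrite ?normrN ?cos_max ?sin_max. Qed.

Let vy_le (t : R) : `|vy t| <= speed t.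
Proof. by apply: velocity_le; rewrite ?cos_max ?sin_max. Qed.

Let speed_le (s t : R) : tint T t -> 0 <= s -> s <= t -> speed s <= speed t.
Proof.
move=> tT s0 st; have Est := E_le _ _ tT s0 st.
have Es := ltW (E_gt0 s); have Ys := ltW (Y_gt0 s).
have Yst : Y s <= Y t by apply: lerXn2r => //; rewrite nnegrE (le_trans Es).
apply: lerD.
  apply: ler_pM => //; first exact: sqr_ge0.
  by apply: lerXn2r => //; rewrite nnegrE (le_trans Ys).
by rewrite ler_pM2l// ler_pM2l//; exact: ler_pM.
Qed.

Hypothesis k_gt0 : (0 < k)%N.

(** By [radial_weight_ge] at [x0 = 1/16], the derivative of [E^k] is at least
    [kappa Y^2 E (X - 1/16)]. *)
Let kappa := k%:R * C * (16^-1 : R) ^+ m.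

Let kappa_gt0 : 0 < kappa.
Proof. by rewrite /kappa !mulr_gt0 ?ltr0n// exprn_gt0. Qed.

(* Arc length is O(E^(n-2)): the oscillating term compensates the zeros of the radial speed,
   as in [lam_unbounded]. *)
Let len (t : R) := 64 / kappa * (E t ^+ k + kappa / 8 * (quad_angle _ (th t) * expR (- lam t))).

Let dlen (t : R) : R := 64 / kappa * (E t ^+ k * (k%:R * (C * (Y t * E t ^+ 2) * A t)) + kappa / 8 *
   ((1 - 8 * X t) * (Y t ^+ 2 * E t ^+ 2 + C * (Y t * E t ^+ 2) * W t) * expR (- lam t) +
    quad_angle _ (th t) * (expR (- lam t) * - (C * (Y t * E t ^+ 2) * A t)))).

Let is_derive_len (t : R) : tint T t -> is_derive t 1 len (dlen t).
Proof.
move=> tT; exact: (is_derive_cM _ _ _ _ _ (is_derive_fD _ _ _ _ _ _ (dEX k t tT)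
  (is_derive_cM _ _ _ _ _ (is_derive_fM _ _ _ _ _ _
     (is_derive_quad_angle _ _ _ _ (dth t tT)) (ds t tT))))).
Qed.

(** Put [P = Y^2 E] and [Q = C Y E <= P/8]. The weight [kappa/8] cancels [X], because
    [(X - 1/16) + (1 - 8 X)/8 = 1/16]. The perturbations cost at most [kappa Q/4 <= kappa P/32],
    leaving [kappa P/32], which the factor [64 / kappa] turns into [2 P >= P + 2 Q]. *)
Let speed_le_dlen (t : R) : tint T t -> t1 <= t -> speed t <= dlen t.
Proof.
move=> tT tt1; have [E1 EY CY] := late_bounds _ tT tt1.
rewrite /dlen.
have -> : E t ^+ k * (k%:R * (C * (Y t * E t ^+ 2) * A t)) + kappa / 8 *
   ((1 - 8 * X t) * (Y t ^+ 2 * E t ^+ 2 + C * (Y t * E t ^+ 2) * W t) * expR (- lam t) +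
    quad_angle _ (th t) * (expR (- lam t) * - (C * (Y t * E t ^+ 2) * A t))) =
   (k%:R * C) * ((Y t * E t * (E t ^+ k * E t)) * A t) + kappa / 8 *
   ((expR (- lam t) * E t) * ((1 - 8 * X t) * (Y t ^+ 2 * E t + C * (Y t * E t) * W t) -
    quad_angle _ (th t) * A t * (C * (Y t * E t)))) by ring.
rewrite sE mul1r -exprSr -/(Y t) /speed.
have -> : Y t * E t * Y t = Y t ^+ 2 * E t by ring.
have hQ : 8 * (C * (Y t * E t)) <= Y t ^+ 2 * E t.
  have -> : 8 * (C * (Y t * E t)) = (8 * C) * (Y t * E t) by ring.
  have -> : Y t ^+ 2 * E t = Y t * (Y t * E t) by ring.
  by apply: ler_wpM2r => //; apply: mulr_ge0; exact: ltW.
have Q0 := CYE_gt0 t; move: (C * (Y t * E t)) Q0 hQ => Q Q0 hQ.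
move: (Y t ^+ 2 * E t) hQ => P hQ.
have P0 : 0 <= P by lra.
have hA : kappa * (P * (X t - 16^-1)) <= k%:R * C * (P * A t).
  have -> : kappa * (P * (X t - 16^-1)) = k%:R * C * (P * ((16^-1) ^+ m * (X t - 16^-1))).
    by rewrite /kappa; ring.
  apply: ler_wpM2l; first by apply: mulr_ge0 => //; exact: ltW.
  by apply: ler_wpM2l => //; apply: A_ge; rewrite invr_ge0.
have X0 := X_ge0 t; have X1 := X_le t.
have hW : - Q <= (1 - 8 * X t) * (Q * W t).
  have h4 : `|(1 - 8 * X t) * (Q * W t)| <= 1 * (Q * 1).
    rewrite normrM normrM; apply: ler_pM; [exact: normr_ge0 | by rewrite mulr_ge0 | | ].
      by rewrite ler_norml; apply/andP; split; lra.
    by rewrite ger0_norm ?(ltW Q0)// ler_wpM2l// ltW.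
  by move: h4; rewrite ler_norml; lra.
have hS : quad_angle _ (th t) * A t * Q <= Q.
  rewrite ler_piMl ?(ltW Q0)//; have := quad_angle_norm_le _ (th t).
  by have := A_ge0 t; have := A_le1 t; rewrite ler_norml => ? ? /andP[? ?]; nra.
have key : kappa * (P / 32) <= k%:R * C * (P * A t) + kappa / 8 *
    ((1 - 8 * X t) * (P + Q * W t) - quad_angle R (th t) * A t * Q).
  have : kappa / 8 * ((1 - 8 * X t) * P - 2 * Q) <= kappa / 8 *
    ((1 - 8 * X t) * (P + Q * W t) - quad_angle R (th t) * A t * Q).
    by apply: ler_wpM2l; [apply: divr_ge0 => //; exact: ltW | lra].
  have : kappa * (P / 32) <= kappa * (P * (X t - 16^-1)) + kappa / 8 * ((1 - 8 * X t) * P - 2 * Q).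
    have -> : kappa * (P * (X t - 16^-1)) + kappa / 8 * ((1 - 8 * X t) * P - 2 * Q) =
      kappa * (P / 16 - Q / 4) by field.
    by rewrite ler_pM2l//; lra.
  by lra.
apply: (@le_trans _ _ (64 / kappa * (kappa * (P / 32)))).
  have -> : 64 / kappa * (kappa * (P / 32)) = 2 * P by field; rewrite gt_eqF.
  lra.
by apply: ler_wpM2l => //; apply: divr_ge0 => //; exact: ltW.
Qed.

(** The oscillating term of [len] has coefficient [64/kappa * kappa/8 = 8] and size at most 1, so a
    shift by 8 gives a nonnegative chart. *)
Let len_bounds (t : R) : tint T t -> t1 <= t -> 0 <= len t + 8 <= 64 / kappa * E t ^+ k + 16.
Proof.
move=> tT tt1; have [E1 _ _] := late_bounds _ tT tt1.
have -> : len t = 64 / kappa * E t ^+ k + 8 * (quad_angle _ (th t) * expR (- lam t)).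
  by rewrite /len; field; rewrite gt_eqF.
have s1 : expR (- lam t) <= 1 by rewrite expRN invf_le1 ?expR_gt0.
have : `|quad_angle _ (th t) * expR (- lam t)| <= 1.
  by rewrite normrM mulr_ile1// ?quad_angle_norm_le// ger0_norm// expR_ge0.
rewrite ler_norml => /andP[h1 h2].
have h3 : 0 <= 64 / kappa * E t ^+ k.
  by apply: mulr_ge0; [apply: divr_ge0 => //; exact: ltW | apply: exprn_ge0; exact: ltW].
by apply/andP; split; lra.
Qed.

(** Time is covered by three ranges: up to [t1], a fixed arc; from [t1] while [E <= 1/e], an arc of
    length O(e^(-k)); and [E >= 1/e], where the inverted curve lies in a square of half-side [e].
    Each contributes O(e^2) at scale [e^(k+2)]. *)
Lemma area_spiral_le (e : R) : 0 < e < 1 ->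
  (area (eps_nbhd Gamma (e ^+ k.+2)) <=
    ((16 * (64 / kappa + 17) + 16 * (speed t1 * t1 + 1) + 16) * e ^+ 2)%:E)%E.
Proof.
move=> /andP[e0 e1].
have ek0 : 0 < e ^+ k.+2 by rewrite exprn_gt0.
have ek2 : e ^+ k.+2 <= e ^+ 2.
  by rewrite -addn2 exprD ler_piMl ?sqr_ge0// exprn_ile1 ?ltW.
have e21 : e ^+ 2 <= 1 by rewrite exprn_ile1 ?ltW.
pose z (t : R) := (expR (- lam t) * cos (th t), expR (- lam t) * sin (th t)).
pose D1 := tint T `&` [set t | t <= t1].
pose D2 := tint T `&` [set t | t1 <= t /\ E t <= e^-1].
pose D3 := tint T `&` [set t | e^-1 <= E t].
have S1 : 0 <= speed t1 by exact: le_trans (normr_ge0 _) (vx_le t1).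
have a1 : (area (eps_nbhd [set z t | t in D1] (e ^+ k.+2)) <= (16 * (speed t1 * t1 + 1) * e ^+ 2)%:E)%E.
  have cvx (s t r : R) : D1 s -> D1 t -> s <= r <= t -> D1 r.
    move=> [[s0 _] _] [tT tt1] /andP[sr rt]; split; last exact: le_trans rt tt1.
    by apply: tint_le tT _; rewrite rt (le_trans s0).
  (* [speed] is nondecreasing, so up to [t1] a linear chart of slope [speed t1] suffices. *)
  have dL (t : R) : D1 t -> is_derive t 1 (fun x => speed t1 * x) (speed t1 * 1).
    by move=> _; exact: is_derive_cM _ id _ _ _ (is_derive_id t 1).
  have sp (t : R) : D1 t -> speed t <= speed t1 * 1.
    by move=> [[t0 _] tt1]; rewrite mulr1 speed_le.
  apply: le_trans (@area_nbhd_Lipschitz_le _ (fun t => expR (- lam t) * cos (th t))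
    (fun t => expR (- lam t) * sin (th t)) (fun t => speed t1 * t) D1 (e ^+ k.+2) (speed t1 * t1) _ _ _ _) _ => //.
  - move=> s t Ds Dt; split.
      exact: (@derive_bound_dist _ D1 _ vx (fun x => speed t1 * x) (fun=> speed t1 * 1) cvx
        (fun r Dr => dx r (proj1 Dr)) dL (fun r Dr => le_trans (vx_le r) (sp r Dr)) s t Ds Dt).
    exact: (@derive_bound_dist _ D1 _ vy (fun x => speed t1 * x) (fun=> speed t1 * 1) cvx
      (fun r Dr => dy r (proj1 Dr)) dL (fun r Dr => le_trans (vy_le r) (sp r Dr)) s t Ds Dt).
  - by rewrite mulr_ge0.
  - by move=> t [[t0 _] tt1]; rewrite mulr_ge0//= ler_wpM2l.
  - have h0 : 0 <= speed t1 * t1 + e ^+ k.+2 by apply: addr_ge0; [exact: mulr_ge0 | exact: ltW].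
    have h1 : speed t1 * t1 + e ^+ k.+2 <= speed t1 * t1 + 1 by lra.
    have h2 : (speed t1 * t1 + e ^+ k.+2) * e ^+ k.+2 <= (speed t1 * t1 + 1) * e ^+ 2.
      by apply: ler_pM => //; exact: ltW.
    by rewrite lee_fin; lra.
have a2 : (area (eps_nbhd [set z t | t in D2] (e ^+ k.+2)) <= (16 * (64 / kappa + 17) * e ^+ 2)%:E)%E.
  have cvx (s t r : R) : D2 s -> D2 t -> s <= r <= t -> D2 r.
    move=> [[s0 _] [st1 _]] [tT [_ Et]] /andP[sr rt].
    have r0 : 0 <= r by exact: le_trans sr.
    split; first by apply: tint_le tT _; rewrite rt r0.
    by split; [exact: le_trans st1 sr | exact: le_trans (E_le _ _ tT r0 rt) Et].
  have dL (t : R) : D2 t -> is_derive t 1 (fun x => len x + 8) (dlen t + 0).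
    by move=> [tT _]; exact: is_derive_fD _ _ _ _ _ _ (is_derive_len t tT) (is_derive_cst _ _ _).
  have sp (t : R) : D2 t -> speed t <= dlen t + 0.
    by move=> [tT [tt1 _]]; rewrite addr0 speed_le_dlen.
  have K0 : 0 <= 64 / kappa by apply: divr_ge0 => //; exact: ltW.
  have Lam0 : 0 <= 64 / kappa * e^-1 ^+ k + 16.
    by rewrite addr_ge0// mulr_ge0// exprn_ge0// invr_ge0 ltW.
  apply: le_trans (@area_nbhd_Lipschitz_le _ (fun t => expR (- lam t) * cos (th t))
    (fun t => expR (- lam t) * sin (th t)) (fun t => len t + 8) D2 (e ^+ k.+2)
    (64 / kappa * e^-1 ^+ k + 16) _ _ _ _) _ => //.
  - move=> s t Ds Dt; split.
      exact: (@derive_bound_dist _ D2 _ vx (fun x => len x + 8) (fun x => dlen x + 0) cvx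
        (fun r Dr => dx r (proj1 Dr)) dL (fun r Dr => le_trans (vx_le r) (sp r Dr)) s t Ds Dt).
    exact: (@derive_bound_dist _ D2 _ vy (fun x => len x + 8) (fun x => dlen x + 0) cvx
      (fun r Dr => dy r (proj1 Dr)) dL (fun r Dr => le_trans (vy_le r) (sp r Dr)) s t Ds Dt).
  - move=> t [tT [tt1 Et]]; have /andP[-> h] := len_bounds _ tT tt1.
    apply: le_trans h _; rewrite lerD2r ler_wpM2l//.
    by apply: lerXn2r => //; rewrite nnegrE ?invr_ge0 ltW ?E_gt0.
  (* Length [e^(-k)] times width [e^(k+2)] is the main [e^2]; the remaining [16 + e^(k+2)] is at
     most 17. *)
  - have eq : e ^+ k.+2 * (64 / kappa * e^-1 ^+ k + 16 + e ^+ k.+2) =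
      64 / kappa * e ^+ 2 + (16 + e ^+ k.+2) * e ^+ k.+2.
      transitivity (64 / kappa * (e ^+ k * e^-1 ^+ k) * e ^+ 2 + (16 + e ^+ k.+2) * e ^+ k.+2).
        by rewrite -addn2 exprD; ring.
      by rewrite -exprMn divff ?gt_eqF// expr1n mulr1.
    have h : (16 + e ^+ k.+2) * e ^+ k.+2 <= 17 * e ^+ 2.
      by apply: ler_pM => //; [apply: addr_ge0 => //; exact: ltW | exact: ltW | lra].
    by rewrite lee_fin -(mulrA 16 (e ^+ k.+2)) eq; lra.
have a3 : (area (eps_nbhd [set z t | t in D3] (e ^+ k.+2)) <= (16 * e ^+ 2)%:E)%E.
  apply: le_trans (@area_nbhd_square _ _ (0, 0) e (e ^+ k.+2) (ltW e0) ek0 _) _.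
    move=> _ [t [tT Et] <-] /=; rewrite !subr0 !normrM.
    have se : expR (- lam t) <= e by rewrite expRN -[e]invrK lef_pV2 ?posrE ?invr_gt0 ?E_gt0.
    rewrite (ger0_norm (expR_ge0 _)).
    by split; rewrite -[leRHS]mulr1; apply: ler_pM; rewrite ?expR_ge0 ?cos_max ?sin_max.
  have eke : e ^+ k.+2 <= e by rewrite exprS ler_piMr ?exprn_ile1 ?(ltW e0) ?(ltW e1).
  rewrite lee_fin; have -> : 16 * e ^+ 2 = 4 * (2 * e) ^+ 2 by ring.
  rewrite ler_pM2l//; apply: lerXn2r; rewrite ?nnegrE; lra.
have sub : eps_nbhd Gamma (e ^+ k.+2) `<=` (eps_nbhd [set z t | t in D2] (e ^+ k.+2) `|`
    eps_nbhd [set z t | t in D1] (e ^+ k.+2)) `|` eps_nbhd [set z t | t in D3] (e ^+ k.+2).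
  move=> p [b [t tT <-] pb].
  have [h|h] := leP t t1; first by left; right; exists (z t) => //; exists t.
  have [h'|h'] := leP (E t) e^-1.
    by left; left; exists (z t) => //; exists t => //; split=> //; split=> //; exact: ltW.
  by right; exists (z t) => //; exists t => //; split=> //; exact: ltW.
have mE B := @measurable_eps_nbhd R B (e ^+ k.+2).
apply: (le_trans (le_area _ _ _ _ _ sub)) => //.
  by apply: measurableU; [apply: measurableU|].
apply: (le_trans (area_setU _ _ _ _ _)) => //; first exact: measurableU.
rewrite 2!mulrDl 2!EFinD; apply: leeD a3.
exact: le_trans (area_setU _ _ _ (mE _) (mE _)) (leeD a2 a1).
Qed.
End PolarDynamics.

(** * From the polar estimates back to the planar system *)

Theorem theorem3p1 (R : realType) (alpha beta : nat) (C : R)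
  (halpha : (0 < alpha)%N) (halpha_even : ~~ odd alpha)
  (hbeta : (0 < beta)%N) (hbeta_odd : odd beta) (hC : 0 < C)
  (u v : R -> R) (T : \bar R) (hT : (0 < T)%E)
  (hinit : (u 0, v 0) <> (0, 0))
  (hsol : forall t, tint T t ->
     is_derive t 1 u (fieldU alpha beta C (u t) (v t)) /\
     is_derive t 1 v (fieldV alpha beta C (u t) (v t)))
  (hmax : T = +oo%E \/
     ~ (exists M : R, forall t, tint T t -> u t ^+ 2 + v t ^+ 2 <= M)) :
  let Gamma := [set (u t, v t) | t in tint T] in
  spiral_to_infinity u v T /\
  upper_box_dim (@inversion R @` Gamma) = (2 * (1 - 1 / (alpha + beta)%:R))%:E /\
  lower_box_dim (@inversion R @` Gamma) = (2 * (1 - 1 / (alpha + beta)%:R))%:E /\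
  mink_nondegenerate (@inversion R @` Gamma).
Proof.
move=> Gamma.
have [lam [th polar]] := polar_form _ _ _ _ halpha_even hbeta_odd hC _ _ _ hT hinit hsol.
(* A positive even [alpha] is at least 2, so [alpha + beta >= 3] and the arc length exponent [k] is
   positive. *)
have [k [k0 hk]] : exists k, (0 < k)%N /\ (alpha + beta = k.+2)%N.
  have a2 : (1 < alpha)%N by move: halpha halpha_even; case: (alpha) => [|[|]].
  have h : (2 < alpha + beta)%N by exact: leq_add a2 hbeta.
  exists (alpha + beta - 2)%N; split; first by rewrite subn_gt0.
  by rewrite -[RHS]addn2 subnK// ltnW.
have hm : (alpha + beta = (alpha + beta)./2.*2.+1)%N.
  by rewrite -[LHS]odd_double_half oddD (negPf halpha_even) hbeta_odd.
set m := (alpha + beta)./2 in hm.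
pose E t := expR (lam t).
have dlam t : tint T t -> is_derive t 1 lam
    (C * (E t ^+ k.+1 * E t ^+ 2) * radial_weight _ alpha beta (th t)).
  move=> tT; have [_ _ d _] := polar t tT; apply: (is_derive_eq d).
  by rewrite hk -exprD addn2.
have dth t : tint T t -> is_derive t 1 th
    ((E t ^+ k.+1) ^+ 2 * E t ^+ 2 + C * (E t ^+ k.+1 * E t ^+ 2) * angular_weight _ alpha beta (th t)).
  move=> tT; have [_ _ _ d] := polar t tT; apply: (is_derive_eq d).
  by rewrite hk mulnC mulSn addnC exprD exprM -exprD addn2.
have uvE t : tint T t -> u t ^+ 2 + v t ^+ 2 = E t ^+ 2.
  by move=> tT; have [-> -> _ _] := polar t tT; rewrite !exprMn -mulrDr cos2Dsin2 mulr1.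
have rE t : tint T t -> Num.sqrt (u t ^+ 2 + v t ^+ 2) = E t.
  by move=> tT; rewrite uvE// sqrtr_sqr ger0_norm// expR_ge0.
(* For [T = +oo] the Lyapunov argument applies, with [Num.max M 1] keeping the logarithm meaningful;
   otherwise unboundedness comes from maximality of the solution. *)
have Einf (M : R) : exists2 t, tint T t & M < E t.
  case: hmax => [Ty|nb].
    have [t tT Mt] := lam_unbounded _ _ _ k m _ halpha_even hbeta_odd hC hm lam th T dlam dth (ln (Num.max M 1)) Ty.
    exists t => //; have M1 : 0 < Num.max M 1 by rewrite lt_max ltr01 orbT.
    by rewrite /E (le_lt_trans _ (_ : Num.max M 1 < _)) ?le_max ?lexx// -[ltLHS]lnK ?posrE// ltr_expR.
  apply/not_exists2P => h; apply: nb; exists (`|M| ^+ 2) => t tT.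
  rewrite uvE//; apply: lerXn2r; rewrite ?nnegrE ?expR_ge0//.
  apply: le_trans (ler_norm _); case: (h t) => // /negP; by rewrite -leNgt.
have lam_le (s t : R) : tint T t -> 0 <= s -> s <= t -> lam s <= lam t.
  exact: (@lam_nondecreasing _ alpha beta k C halpha_even hbeta_odd hC lam th T dlam).
have [t1 t1T /ltW E1] := Einf (8 * C + 1).
split; last first.
  have -> : @inversion R @` Gamma =
      [set (expR (- lam t) * cos (th t), expR (- lam t) * sin (th t)) | t in tint T].
    rewrite /Gamma image_comp; apply: eq_imagel => t tT /=.
    rewrite /inversion /= uvE//; have [-> -> _ _] := polar t tT.
    rewrite expRN -/(E t); have E0 : E t != 0 by rewrite gt_eqF// expR_gt0.
    by congr (_, _); field.
  rewrite hk; set B := [set _ | t in _].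
  have [K hK] : exists K, forall e, 0 < e < 1 ->
      (area (eps_nbhd B (e ^+ k.+2)) <= (K * e ^+ 2)%:E)%E.
    by eexists; exact: (@area_spiral_le _ alpha beta k m C halpha_even hbeta_odd hC hm
      lam th T dlam dth t1 t1T E1 k0).
  (* The threshold combines [e < 1] for the upper bound with [e * E t1 <= 1] for the lower one. *)
  apply: (@minkowski_of_power_bounds _ _ k.+2 ((4 * (4 * pi * C + 1))^-1 ^+ 2) K
    (Num.min 1 (E t1)^-1)) => //.
  - by rewrite lt_min ltr01 invr_gt0 expR_gt0.
  - by rewrite exprn_gt0// invr_gt0 mulr_gt0// ltr_wpDl// !mulr_ge0 ?pi_ge0// ltW.
  - move=> e /andP[e0]; rewrite lt_min => /andP[e1 eE]; split; last by apply: hK; rewrite e0.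
    apply: (@area_spiral_ge _ alpha beta k C halpha_even hbeta_odd hC
      lam th T dlam dth Einf t1 t1T E1 e e0).
    by rewrite -ler_pdivlMr ?expR_gt0// mul1r ltW.
split; [|split; [|split]].
- move=> t tT /pair_equal_spec[u0 v0]; have := uvE t tT.
  by rewrite u0 v0 expr0n addr0 => /eqP; rewrite eq_sym sqrf_eq0 gt_eqF// expR_gt0.
- move=> s t sT tT st; rewrite !rE// ler_expR; apply: lam_le => //; by case: sT.
- move=> M; have [s sT Ms] := Einf M; exists s => // t tT st.
  rewrite rE//; apply: lt_le_trans Ms _; rewrite ler_expR; apply: lam_le => //; by case: sT.
- exists th; split; [|split].
  + apply: continuous_in_subspaceT => t; rewrite inE => tT.
    exact: is_derive_cont _ _ _ _ (dth t tT).
  + by move=> t tT; rewrite rE//; have [] := polar t tT.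
  (* The main term of the angular velocity is positive, so the rotation is eventually
     counterclockwise. *)
  + exists t1 => //; left; split.
      move=> s t sT tT; exact: (@th_increasing _ alpha beta k C halpha_even hbeta_odd hC lam th T dlam dth t1 t1T E1).
    exact: (@th_tends_to_infty _ alpha beta k C halpha_even hbeta_odd hC lam th T dlam dth Einf t1 t1T E1).
Qed.
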